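(* Let $\mathcal C$ be a braided monoidal category with a class $\mathcal Q$ of regular epimorphisms satisfying the standing assumptions, and let $\mathcal M$ be the category described in the context. The category $\mathcal M$ is monoidal with respect to the usual monoidal product of semigroups (the product of $A$ and $B$ being $AB$ with multiplication $mm.1c1\colon (AB)^2\to AB$), and with the monoidal product of morphisms $f\colon A\nrightarrow B$ and $f'\colon A'\nrightarrow B'$ given by the $\mathbb M$-morphism $AA'\nrightarrow BB'$ with components $$f_1f'_1.1c1\colon AA'BB'\to BB',\qquad f_2f'_2.1c1\colon BB'AA'\to BB'.$$
   Context: Conventions. $\mathcal C$ is a braided monoidal category with monoidal unit $I$ and braiding $c$. The monoidal product is written by juxtaposition (of objects and of morphisms), associativity and unit isomorphisms are suppressed, $A^n$ is the $n$-fold monoidal power, $1$ denotes an identity morphism, and $g.f$ is the composite of $f\colon A\to B$ and $g\colon B\to C$. Standing assumptions on $\mathcal Q$. $\mathcal Q$ is a class of regular epimorphisms in $\mathcal C$ which contains the isomorphisms, is closed under composition and monoidal product, and is right-cancellative: if $s\colon A\to B$ and $t.s\colon A\to C$ are in $\mathcal Q$ then so is $t\colon B\to C$. Moreover each $q\in\mathcal Q$ is the coequalizer of some pair of morphisms, chosen so that this coequalizer is preserved by taking the monoidal product with any object. Semigroups. A semigroup is a pair $(A,m)$ with $m\colon A^2\to A$ satisfying $m.m1=m.1m$. It is non-degenerate if for all objects $X,Y$ both maps $\mathcal C(X,YA)\to\mathcal C(XA,YA)$, $f\mapsto 1m.f1$, and $\mathcal C(X,AY)\to\mathcal C(AX,AY)$,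 $g\mapsto m1.1g$, are injective. $\mathbb M$-morphisms. For an object $A$ and a non-degenerate semigroup $B$, an $\mathbb M$-morphism $f\colon A\nrightarrow B$ is a pair of morphisms (components) $f_1\colon AB\to B$, $f_2\colon BA\to B$ with $m.1f_1=m.f_21\colon BAB\to B$. It is dense if $f_1,f_2\in\mathcal Q$. If $A$ is a semigroup, $f$ is multiplicative if $f_1.1f_1=f_1.m1\colon A^2B\to B$ and $f_2.f_21=f_2.1m\colon BA^2\to B$. The category $\mathcal M$. Objects: non-degenerate semigroups whose multiplication lies in $\mathcal Q$. Morphisms: dense multiplicative $\mathbb M$-morphisms. The composite $g\bullet f\colon A\nrightarrow C$ of $f\colon A\nrightarrow B$ and $g\colon B\nrightarrow C$ is the unique $\mathbb M$-morphism with $(g\bullet f)_1.1g_1=g_1.f_11\colon ABC\to C$ and $(g\bullet f)_2.g_21=g_2.1f_2\colon CBA\to C$. The identity on $A$ has both components equal to $m$. The monoidal unit of $\mathcal M$ is $I$ with its trivial multiplication, and the associativity and unit isomorphisms are those induced from $\mathcal C$: a semigroup isomorphism $f\colon A\to B$ induces the $\mathbb M$-morphism $f^\#\colon A\nrightarrow B$ with components $m.f1\colon AB\to B$ and $m.1f\colon BA\to B$. *)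

(* Defs.v *)
From Stdlib Require Import ssreflect.
From Stdlib Require Import ClassicalEpsilon ProofIrrelevance.

Set Implicit Arguments.
Unset Strict Implicit.
Unset Printing Implicit Defensive.

Record Category := {
  Ob :> Type;
  Hom : Ob -> Ob -> Type;
  idm : forall A, Hom A A;
  comp : forall A B C, Hom B C -> Hom A B -> Hom A C;
  comp_idl : forall A B (f : Hom A B), comp (idm B) f = f;
  comp_idr : forall A B (f : Hom A B), comp f (idm A) = f;
  comp_assoc : forall A B C D (h : Hom C D) (g : Hom B C) (f : Hom A B),
    comp (comp h g) f = comp h (comp g f)
}.
Arguments Hom {c} A B.
Arguments idm {c} A.
Arguments comp {c A B C} g f.

Notation "A ~> B" := (Hom A B) (at level 90, B at next level).
Notation "g ∘ f" := (comp g f) (at level 40, left associativity).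

Definition IsInverse (C : Category) (A B : C) (f : A ~> B) (g : B ~> A) : Prop :=
  g ∘ f = idm A /\ f ∘ g = idm B.

Definition IsIso (C : Category) (A B : C) (f : A ~> B) : Prop :=
  exists g, IsInverse f g.

Definition IsCoequalizer (C : Category) (X A B : C) (u v : X ~> A) (q : A ~> B)
  : Prop :=
  q ∘ u = q ∘ v /\
  forall D (w : A ~> D), w ∘ u = w ∘ v -> exists! k : B ~> D, k ∘ q = w.

Record MonoidalData (C : Category) := {
  tensO : C -> C -> C;
  tensM : forall A A' B B' : C,
    (A ~> A') -> (B ~> B') -> (tensO A B ~> tensO A' B');
  unitO : C;
  assoc : forall A B D : C, tensO (tensO A B) D ~> tensO A (tensO B D);
  assoc_inv : forall A B D : C, tensO A (tensO B D) ~> tensO (tensO A B) D;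
  lunit : forall A : C, tensO unitO A ~> A;
  lunit_inv : forall A : C, A ~> tensO unitO A;
  runit : forall A : C, tensO A unitO ~> A;
  runit_inv : forall A : C, A ~> tensO A unitO
}.
Arguments tensO {C} m A B.
Arguments tensM {C} m {A A' B B'} f g.
Arguments unitO {C} m.
Arguments assoc {C} m A B D.
Arguments assoc_inv {C} m A B D.
Arguments lunit {C} m A.
Arguments lunit_inv {C} m A.
Arguments runit {C} m A.
Arguments runit_inv {C} m A.

Record IsMonoidal (C : Category) (T : MonoidalData C) : Prop := {
  tens_id : forall A B : C, tensM T (idm A) (idm B) = idm (tensO T A B);
  tens_comp : forall (A A' A'' B B' B'' : C)
      (f : A ~> A') (f' : A' ~> A'') (g : B ~> B') (g' : B' ~> B''),
    tensM T (f' ∘ f) (g' ∘ g) = tensM T f' g' ∘ tensM T f g;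
  assoc_iso : forall A B D : C, IsInverse (assoc T A B D) (assoc_inv T A B D);
  lunit_iso : forall A : C, IsInverse (lunit T A) (lunit_inv T A);
  runit_iso : forall A : C, IsInverse (runit T A) (runit_inv T A);
  assoc_nat : forall (A A' B B' D D' : C)
      (f : A ~> A') (g : B ~> B') (h : D ~> D'),
    assoc T A' B' D' ∘ tensM T (tensM T f g) h
      = tensM T f (tensM T g h) ∘ assoc T A B D;
  lunit_nat : forall (A A' : C) (f : A ~> A'),
    lunit T A' ∘ tensM T (idm (unitO T)) f = f ∘ lunit T A;
  runit_nat : forall (A A' : C) (f : A ~> A'),
    runit T A' ∘ tensM T f (idm (unitO T)) = f ∘ runit T A;
  pentagon : forall A B D E : C,
    assoc T A B (tensO T D E) ∘ assoc T (tensO T A B) D E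
      = tensM T (idm A) (assoc T B D E) ∘ assoc T A (tensO T B D) E
          ∘ tensM T (assoc T A B D) (idm E);
  triangle : forall A B : C,
    tensM T (idm A) (lunit T B) ∘ assoc T A (unitO T) B
      = tensM T (runit T A) (idm B)
}.

Record MonoidalCategory := {
  mc_cat :> Category;
  mc_data : MonoidalData mc_cat;
  mc_ax : IsMonoidal mc_data
}.

Notation "A ⊗ B" := (tensO (mc_data _) A B) (at level 35, right associativity).
Notation "f ⊠ g" := (tensM (mc_data _) f g) (at level 35, right associativity).
Notation α := (assoc (mc_data _)).
Notation αi := (assoc_inv (mc_data _)).
Notation λ := (lunit (mc_data _)).
Notation ρ := (runit (mc_data _)).
Notation λi := (lunit_inv (mc_data _)).
Notation ρi := (runit_inv (mc_data _)).
Notation "'𝟙'" := (unitO (mc_data _)).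

Record BraidedMonoidalCategory := {
  bmc_mc :> MonoidalCategory;
  braid : forall A B : bmc_mc, A ⊗ B ~> B ⊗ A;
  braid_iso : forall A B : bmc_mc, IsIso (braid A B);
  braid_nat : forall (A A' B B' : bmc_mc) (f : A ~> A') (g : B ~> B'),
    braid A' B' ∘ (f ⊠ g) = (g ⊠ f) ∘ braid A B;
  hexagon1 : forall A B D : bmc_mc,
    α B D A ∘ braid A (B ⊗ D) ∘ α A B D
      = (idm B ⊠ braid A D) ∘ α B A D ∘ (braid A B ⊠ idm D);
  hexagon2 : forall A B D : bmc_mc,
    αi D A B ∘ braid (A ⊗ B) D ∘ αi A B D
      = (braid A D ⊠ idm B) ∘ αi A D B ∘ (idm A ⊠ braid B D)
}.
Arguments braid {b} A B.

Definition MorphismClass (C : Category) := forall A B : C, (A ~> B) -> Prop.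

Record Admissible (V : MonoidalCategory) (Q : MorphismClass V) : Prop := {
  Q_iso : forall (A B : V) (f : A ~> B), IsIso f -> Q A B f;
  Q_comp : forall (A B D : V) (f : A ~> B) (g : B ~> D),
    Q A B f -> Q B D g -> Q A D (g ∘ f);
  Q_tens : forall (A A' B B' : V) (f : A ~> A') (g : B ~> B'),
    Q A A' f -> Q B B' g -> Q (A ⊗ B) (A' ⊗ B') (f ⊠ g);
  Q_cancel : forall (A B D : V) (s : A ~> B) (t : B ~> D),
    Q A B s -> Q A D (t ∘ s) -> Q B D t;
  (* in particular every member of Q is a regular epimorphism *)
  Q_coeq : forall (A B : V) (q : A ~> B), Q A B q ->
    exists (X : V) (u v : X ~> A),
      IsCoequalizer u v q /\
      forall Z : V,
        IsCoequalizer (idm Z ⊠ u) (idm Z ⊠ v) (idm Z ⊠ q) /\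
        IsCoequalizer (u ⊠ idm Z) (v ⊠ idm Z) (q ⊠ idm Z)
}.

(* The data of a semigroup; associativity is the predicate IsSemigroup. *)
Record Magma (V : MonoidalCategory) := {
  car :> V;
  mul : car ⊗ car ~> car
}.
Arguments mul {V} m.

Definition IsSemigroup (V : MonoidalCategory) (A : Magma V) : Prop :=
  mul A ∘ (mul A ⊠ idm A) = mul A ∘ (idm A ⊠ mul A) ∘ α A A A.

Definition NonDegenerate (V : MonoidalCategory) (A : Magma V) : Prop :=
  forall X Y : V,
    (forall f f' : X ~> Y ⊗ A,
       (idm Y ⊠ mul A) ∘ α Y A A ∘ (f ⊠ idm A)
         = (idm Y ⊠ mul A) ∘ α Y A A ∘ (f' ⊠ idm A) -> f = f') /\
    (forall g g' : X ~> A ⊗ Y,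
       (mul A ⊠ idm Y) ∘ αi A A Y ∘ (idm A ⊠ g)
         = (mul A ⊠ idm Y) ∘ αi A A Y ∘ (idm A ⊠ g') -> g = g').

Record Components (V : MonoidalCategory) (A : V) (B : Magma V) := {
  fst_ : A ⊗ B ~> B;
  snd_ : B ⊗ A ~> B
}.
Arguments fst_ {V A B} c.
Arguments snd_ {V A B} c.

Notation "f '.₁'" := (fst_ f) (at level 2, left associativity, format "f '.₁'").
Notation "f '.₂'" := (snd_ f) (at level 2, left associativity, format "f '.₂'").

Definition IsMMorphism (V : MonoidalCategory) (A : V) (B : Magma V)
    (f : Components A B) : Prop :=
  mul B ∘ (idm B ⊠ f.₁) ∘ α B A B = mul B ∘ (f.₂ ⊠ idm B).

Definition Dense (V : MonoidalCategory) (Q : MorphismClass V)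
    (A : V) (B : Magma V) (f : Components A B) : Prop :=
  Q _ _ f.₁ /\ Q _ _ f.₂.

Definition Multiplicative (V : MonoidalCategory) (A B : Magma V)
    (f : Components A B) : Prop :=
  f.₁ ∘ (idm A ⊠ f.₁) ∘ α A A B = f.₁ ∘ (mul A ⊠ idm B) /\
  f.₂ ∘ (f.₂ ⊠ idm A) = f.₂ ∘ (idm B ⊠ mul A) ∘ α B A A.

Definition IsMObject (V : MonoidalCategory) (Q : MorphismClass V) (A : Magma V)
  : Prop := IsSemigroup A /\ NonDegenerate A /\ Q _ _ (mul A).

Definition IsMHom (V : MonoidalCategory) (Q : MorphismClass V) (A B : Magma V)
    (f : Components A B) : Prop :=
  IsMMorphism f /\ Dense Q f /\ Multiplicative f.

Record MObject (V : MonoidalCategory) (Q : MorphismClass V) := {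
  mob :> Magma V;
  mob_ax : IsMObject Q mob
}.

Record MHom (V : MonoidalCategory) (Q : MorphismClass V) (A B : MObject Q) := {
  mhom :> Components A B;
  mhom_ax : IsMHom Q mhom
}.

(* The two equations characterizing h = g • f. *)
Definition IsComposite (V : MonoidalCategory) (A : V) (B D : Magma V)
    (g : Components B D) (f : Components A B) (h : Components A D) : Prop :=
  h.₁ ∘ (idm A ⊠ g.₁) ∘ α A B D = g.₁ ∘ (f.₁ ⊠ idm D) /\
  h.₂ ∘ (g.₂ ⊠ idm A) = g.₂ ∘ (idm D ⊠ f.₂) ∘ α D B A.

Definition idComponents (V : MonoidalCategory) (A : Magma V) : Components A A :=
  {| fst_ := mul A; snd_ := mul A |}.

Definition sharp (V : MonoidalCategory) (A B : Magma V) (f : A ~> B) :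
    Components A B :=
  {| fst_ := mul B ∘ (f ⊠ idm B); snd_ := mul B ∘ (idm B ⊠ f) |}.
Arguments sharp {V} A B f.

Lemma components_eq (V : MonoidalCategory) (A : V) (B : Magma V)
    (f g : Components A B) : f.₁ = g.₁ -> f.₂ = g.₂ -> f = g.
Proof. by case: f => a b; case: g => c d /= -> ->. Qed.

Lemma MHom_eq (V : MonoidalCategory) (Q : MorphismClass V) (A B : MObject Q)
    (f g : MHom A B) : mhom f = mhom g -> f = g.
Proof.
case: f => f fP; case: g => g gP /= e; rewrite -e in gP *.
by rewrite (proof_irrelevance _ fP gP).
Qed.

Section Calculus.
Context (V : MonoidalCategory).
Implicit Types A B D E X Y Z : V.

Let T := mc_ax V.

(* A morphism A ⊗ B ~> D acts on right-bracketed words A ⊗ (B ⊗ X); an equation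
   q.(p 1) = s.(1 r).α is equivalent to one between such actions, in which no
   associativity isomorphism occurs. *)
Fact act_key : unit. Proof. exact tt. Qed.
Definition act A B D (f : A ⊗ B ~> D) X : A ⊗ B ⊗ X ~> D ⊗ X :=
  locked_with act_key ((f ⊠ idm X) ∘ αi A B X).
Definition coact X A B (u : X ~> A ⊗ B) Y : X ⊗ Y ~> A ⊗ B ⊗ Y :=
  locked_with act_key (α A B Y ∘ (u ⊠ idm Y)).
Definition wh A X Y (f : X ~> Y) : A ⊗ X ~> A ⊗ Y :=
  locked_with act_key (idm A ⊠ f).

Lemma actD A B D (f : A ⊗ B ~> D) X : act f X = (f ⊠ idm X) ∘ αi A B X.
Proof. by rewrite /act locked_withE. Qed.
Lemma coactD X A B (u : X ~> A ⊗ B) Y : coact u Y = α A B Y ∘ (u ⊠ idm Y).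
Proof. by rewrite /coact locked_withE. Qed.
Lemma whD A X Y (f : X ~> Y) : wh A f = idm A ⊠ f.
Proof. by rewrite /wh locked_withE. Qed.

Lemma wh_comp A X Y Z (g : Y ~> Z) (f : X ~> Y) :
  wh A (g ∘ f) = wh A g ∘ wh A f.
Proof. by rewrite !whD -(tens_comp T) comp_idl. Qed.

Lemma assocK A B D : αi A B D ∘ α A B D = idm _.
Proof. by case: (assoc_iso T A B D). Qed.
Lemma assocKi A B D : α A B D ∘ αi A B D = idm _.
Proof. by case: (assoc_iso T A B D). Qed.

Lemma assoc_inv_nat A A' B B' D D' (f : A ~> A') (g : B ~> B') (h : D ~> D') :
  αi A' B' D' ∘ (f ⊠ g ⊠ h) = ((f ⊠ g) ⊠ h) ∘ αi A B D.
Proof.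
rewrite -[LHS]comp_idr -(assocKi A B D) -comp_assoc; congr (_ ∘ _).
by rewrite comp_assoc -(assoc_nat T) -comp_assoc assocK comp_idl.
Qed.

Lemma act_nat A B D (f : A ⊗ B ~> D) X Y (x : X ~> Y) :
  act f Y ∘ wh A (wh B x) = wh D x ∘ act f X.
Proof.
rewrite !actD !whD comp_assoc assoc_inv_nat (tens_id T) -!comp_assoc.
by rewrite -!(tens_comp T) !comp_idl !comp_idr.
Qed.

Lemma coact_nat X A B (u : X ~> A ⊗ B) Y Z (y : Y ~> Z) :
  coact u Z ∘ wh X y = wh A (wh B y) ∘ coact u Y.
Proof.
rewrite !coactD !whD comp_assoc -(tens_comp T) comp_idl comp_idr -!comp_assoc.
rewrite -(assoc_nat T) (tens_id T) comp_assoc -(tens_comp T) comp_idl.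
by rewrite comp_idr.
Qed.

Lemma act_wh A B D X Y (s : A ⊗ D ~> X) (r : B ~> D) :
  act s Y ∘ wh A (r ⊠ idm Y) = act (s ∘ wh A r) Y.
Proof.
rewrite !actD !whD comp_assoc assoc_inv_nat -!comp_assoc -(tens_comp T).
by rewrite comp_idl.
Qed.

Lemma act_tens A B D X Y (s : D ⊗ B ~> X) (r : A ~> D) :
  act s Y ∘ (r ⊠ idm _) = act (s ∘ (r ⊠ idm B)) Y.
Proof.
rewrite !actD comp_assoc -(tens_id T B Y) assoc_inv_nat -!comp_assoc.
by rewrite -(tens_comp T) comp_idl.
Qed.

Lemma act_comp A B D X (s : D ~> X) (r : A ⊗ B ~> D) Y :
  act (s ∘ r) Y = (s ⊠ idm Y) ∘ act r Y.
Proof. by rewrite !actD -comp_assoc -(tens_comp T) comp_idl. Qed.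

Lemma unit_faithful X Y (f g : X ~> Y) :
  f ⊠ idm 𝟙 = g ⊠ idm 𝟙 -> f = g.
Proof.
move=> e; case: (runit_iso T X) => _ e2.
rewrite -[f]comp_idr -[g]comp_idr -e2 -!comp_assoc.
by rewrite -!(runit_nat T) e.
Qed.

Lemma act_inj A B D (f g : A ⊗ B ~> D) : (forall X, act f X = act g X) -> f = g.
Proof.
move=> e; apply: unit_faithful.
rewrite -[LHS]comp_idr -[RHS]comp_idr -(assocK A B 𝟙) -!comp_assoc.
by rewrite -!actD e.
Qed.

Section Square.
Context A B D E F G (p : A ⊗ B ~> E) (q : E ⊗ D ~> G) (r : B ⊗ D ~> F)
  (s : A ⊗ F ~> G).

Lemma pentagon_act X :
  act (α A B D) X ∘ act (idm (A ⊗ B)) (D ⊗ X)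
    = αi A (B ⊗ D) X ∘ wh A (αi B D X).
Proof.
rewrite !actD (tens_id T) comp_idl.
set u := α A B D ⊠ idm X.
have pent : α A B (D ⊗ X) ∘ α (A ⊗ B) D X
   = wh A (α B D X) ∘ α A (B ⊗ D) X ∘ u by rewrite whD; apply: (pentagon T).
have e1 : wh A (αi B D X) ∘ wh A (α B D X) = idm _.
  by rewrite -wh_comp assocK !whD (tens_id T).
have -> : u = αi A (B ⊗ D) X ∘ (wh A (αi B D X)
   ∘ (α A B (D ⊗ X) ∘ α (A ⊗ B) D X)).
  rewrite pent -2!(comp_assoc (wh A (αi B D X))) e1 comp_idl.
  by rewrite -comp_assoc assocK comp_idl.
rewrite !comp_assoc -(comp_assoc (α (A ⊗ B) D X)) assocKi comp_idl.
by rewrite assocKi comp_idr.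
Qed.

Lemma act_square_l X :
  act q X ∘ act p (D ⊗ X)
   = ((q ∘ (p ⊠ idm D)) ⊠ idm X) ∘ αi (A ⊗ B) D X ∘ αi A B (D ⊗ X).
Proof.
by rewrite (actD p) -comp_assoc act_tens actD.
Qed.

Lemma act_square_r X :
  act s X ∘ wh A (act r X)
   = ((s ∘ wh A r ∘ α A B D) ⊠ idm X) ∘ αi (A ⊗ B) D X ∘ αi A B (D ⊗ X).
Proof.
rewrite (actD r) wh_comp -comp_assoc act_wh actD comp_assoc -pentagon_act.
rewrite !actD (tens_id T) comp_idl -!comp_assoc -(tens_comp T) comp_idl.
by [].
Qed.

Lemma act_square :
  s ∘ (idm A ⊠ r) ∘ α A B D = q ∘ (p ⊠ idm D) <->
  (forall X, act s X ∘ wh A (act r X) = act q X ∘ act p (D ⊗ X)).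
Proof.
split=> [e X | e]; first by rewrite act_square_l act_square_r !whD e.
apply: unit_faithful.
have := e 𝟙; rewrite act_square_l act_square_r => e1.
have {}e1 := f_equal (fun z => z ∘ (α A B (D ⊗ 𝟙) ∘ α (A ⊗ B) D 𝟙)) e1.
move: e1; rewrite /= !comp_assoc -!(comp_assoc (αi A B (D ⊗ 𝟙))) !assocK.
by rewrite !comp_idl !assocK !comp_idr !whD.
Qed.
End Square.
End Calculus.

Lemma tail (C : Category) (X Y Y' Z : C) (g : Y ~> Z) (f : X ~> Y)
    (g' : Y' ~> Z) (f' : X ~> Y') : g ∘ f = g' ∘ f' ->
  forall W (t : W ~> X), g ∘ (f ∘ t) = g' ∘ (f' ∘ t).
Proof. by move=> e W t; rewrite -!comp_assoc e. Qed.

Lemma wh_tail (V : MonoidalCategory) (A X Y Y' Z : V) (g : Y ~> Z) (f : X ~> Y)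
    (g' : Y' ~> Z) (f' : X ~> Y') : g ∘ f = g' ∘ f' ->
  forall W (t : W ~> A ⊗ X),
    wh A g ∘ (wh A f ∘ t) = wh A g' ∘ (wh A f' ∘ t).
Proof. by move=> e; apply: tail; rewrite -!wh_comp e. Qed.

Lemma ext (C : Category) (X Y : C) (f g : X ~> Y) :
  (forall W (t : W ~> X), f ∘ t = g ∘ t) -> f = g.
Proof. by move=> /(_ _ (idm X)); rewrite !comp_idr. Qed.

Section Composition.
Context (V : MonoidalCategory) (Q : MorphismClass V) (HQ : Admissible Q).
Arguments Q : clear implicits.
Let T := mc_ax V.

Lemma Q_id (A : V) : Q _ _ (idm A).
Proof. by apply: (Q_iso HQ); exists (idm A); split; rewrite comp_idl. Qed.

Lemma Q_epi (A B : V) (q : A ~> B) : Q _ _ q ->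
  forall X (f g : B ~> X), f ∘ q = g ∘ q -> f = g.
Proof.
move=> /(Q_coeq HQ)[X [u [v [[e up] _]]]] Y f g fg.
have e1 : (g ∘ q) ∘ u = (g ∘ q) ∘ v by rewrite !comp_assoc e.
by case: (up _ _ e1) => k [_ uk]; rewrite -(uk f fg) -(uk g).
Qed.

Lemma Q_whl (A X Y : V) (f : X ~> Y) : Q _ _ f -> Q _ _ (idm A ⊠ f).
Proof. by move=> Qf; apply: (Q_tens HQ) => //; apply: Q_id. Qed.

Lemma Q_wh (A X Y : V) (f : X ~> Y) : Q _ _ f -> Q _ _ (wh A f).
Proof. by rewrite whD; apply: Q_whl. Qed.

Lemma Q_whr (A X Y : V) (f : X ~> Y) : Q _ _ f -> Q _ _ (f ⊠ idm A).
Proof. by move=> Qf; apply: (Q_tens HQ) => //; apply: Q_id. Qed.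

Lemma Q_assoc (A B D : V) : Q _ _ (α A B D).
Proof. by apply: (Q_iso HQ); exists (αi A B D); apply: (assoc_iso T). Qed.

Lemma Q_act (A B D X : V) (f : A ⊗ B ~> D) : Q _ _ f -> Q _ _ (act f X).
Proof.
move=> Qf; rewrite actD; apply: (Q_comp HQ); last exact: Q_whr.
apply: (Q_iso HQ); exists (α A B X).
by split; [apply: assocKi | apply: assocK].
Qed.

Lemma nondeg_l (D : Magma V) (X : V) (k k' : X ~> D) : NonDegenerate D ->
  mul D ∘ (idm D ⊠ k) = mul D ∘ (idm D ⊠ k') -> k = k'.
Proof.
move=> nd e; apply: unit_faithful; apply: (proj2 (nd _ 𝟙)).
have re (z : X ~> D) : (mul D ⊠ idm 𝟙) ∘ αi D D 𝟙 ∘ (idm D ⊠ z ⊠ idm 𝟙)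
    = act (mul D ∘ wh D z) 𝟙 by rewrite -act_wh actD whD.
by rewrite !re !whD e.
Qed.

Lemma nondeg_r (D : Magma V) (X : V) (k k' : X ~> D) : NonDegenerate D ->
  mul D ∘ (k ⊠ idm D) = mul D ∘ (k' ⊠ idm D) -> k = k'.
Proof.
move=> nd e; case: (lunit_iso T X) => _ e2.
rewrite -[k]comp_idr -[k']comp_idr -e2 -!comp_assoc -!(lunit_nat T).
congr (_ ∘ _ ∘ _); apply: (proj1 (nd _ 𝟙)).
have re (z : X ~> D) : (idm 𝟙 ⊠ mul D) ∘ α 𝟙 D D ∘ ((idm 𝟙 ⊠ z) ⊠ idm D)
    = wh 𝟙 (mul D ∘ (z ⊠ idm D)) ∘ α 𝟙 X D.
  by rewrite comp_assoc (assoc_nat T) wh_comp comp_assoc !whD.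
by rewrite !re e.
Qed.

Lemma nondeg_act_l (D : Magma V) (X : V) (k k' : X ~> D) : NonDegenerate D ->
  (forall Y, act (mul D) Y ∘ wh D (k ⊠ idm Y)
           = act (mul D) Y ∘ wh D (k' ⊠ idm Y)) -> k = k'.
Proof.
move=> nd e; apply: (nondeg_l nd); apply: act_inj => Y; rewrite -!whD.
by have := e Y; rewrite !act_wh.
Qed.

Lemma nondeg_act_r (D : Magma V) (X : V) (k k' : X ~> D) : NonDegenerate D ->
  (forall Y, act (mul D) Y ∘ (k ⊠ idm (D ⊗ Y))
           = act (mul D) Y ∘ (k' ⊠ idm (D ⊗ Y))) -> k = k'.
Proof.
move=> nd e; apply: (nondeg_r nd); apply: act_inj => Y.
by have := e Y; rewrite !act_tens.
Qed.

Lemma actE (A B D Y : V) (f : A ⊗ B ~> D) :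
  f ⊠ idm Y = act f Y ∘ α A B Y.
Proof. by rewrite !actD comp_assoc assocK comp_idr. Qed.

Lemma coact_eq (A B D X : V) (q : A ⊗ B ~> D) (u v : X ~> A ⊗ B) Y :
  q ∘ u = q ∘ v -> act q Y ∘ coact u Y = act q Y ∘ coact v Y.
Proof.
move=> e.
have re (z : X ~> A ⊗ B) : act q Y ∘ coact z Y = (q ∘ z) ⊠ idm Y.
  rewrite !actD !coactD comp_assoc -(comp_assoc (αi A B Y)) assocK comp_idl.
  by rewrite -(tens_comp T) comp_idl.
by rewrite !re e.
Qed.

Lemma fst_tail (A B D X Y : V) (f : A ⊗ B ~> B) (g : B ⊗ D ~> D)
    (u : X ~> B ⊗ D) :
  (g ∘ (f ⊠ idm D) ∘ αi A B D ∘ (idm A ⊠ u)) ⊠ idm Y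
    = act g Y ∘ (act f (D ⊗ Y) ∘ (wh A (coact u Y) ∘ α A X Y)).
Proof.
have -> : wh A (coact u Y) ∘ α A X Y
    = wh A (α B D Y) ∘ α A (B ⊗ D) Y ∘ (wh A u ⊠ idm Y).
  by rewrite !coactD wh_comp !comp_assoc !whD (assoc_nat T).
have pent := pentagon T A B D Y.
have e1 : (αi A B D ⊠ idm Y) = αi (A ⊗ B) D Y ∘ αi A B (D ⊗ Y)
    ∘ (wh A (α B D Y) ∘ α A (B ⊗ D) Y).
  rewrite -[wh A (α B D Y) ∘ _]comp_idr.
  have -> : idm _ = (α A B D ⊠ idm Y) ∘ (αi A B D ⊠ idm Y).
    by rewrite -(tens_comp T) assocKi comp_idl (tens_id T).
  rewrite -(comp_assoc (wh A _ ∘ _)) !whD -pent !comp_assoc.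
  rewrite -(comp_assoc (αi A B (D ⊗ Y))) assocK comp_idl.
  by rewrite -(comp_assoc (αi (A ⊗ B) D Y)) assocK comp_idl.
rewrite -(comp_assoc (act g Y) (act f (D ⊗ Y))) act_square_l.
rewrite -(comp_assoc _ (_ ∘ _) (wh A u ⊠ _)) (comp_assoc _ (αi (A ⊗ B) D Y)).
rewrite (comp_assoc _ _ (wh A _ ∘ _)) -e1 -!(tens_comp T) !comp_idl.
by rewrite whD.
Qed.

Lemma snd_tail (A B D X Y : V) (f : B ⊗ A ~> B) (g : D ⊗ B ~> D)
    (u : X ~> D ⊗ B) :
  (g ∘ (idm D ⊠ f) ∘ α D B A ∘ (u ⊠ idm A)) ⊠ idm Y
    = act g Y ∘ (wh D (act f Y) ∘ (coact u (A ⊗ Y) ∘ α X A Y)).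
Proof.
rewrite -(comp_assoc (act g Y)) act_square_r.
have -> : coact u (A ⊗ Y) ∘ α X A Y
    = α D B (A ⊗ Y) ∘ (α (D ⊗ B) A Y ∘ ((u ⊠ idm A) ⊠ idm Y)).
  by rewrite (assoc_nat T) !coactD comp_assoc (tens_id T).
rewrite !comp_assoc -(comp_assoc (αi D B (A ⊗ Y))) assocK comp_idl.
rewrite -(comp_assoc (αi (D ⊗ B) A Y)) assocK comp_idl -(tens_comp T) comp_idl.
by rewrite !whD !comp_assoc.
Qed.

Section Core.
Context (A : V) (B D : Magma V) (f : Components A B) (g : Components B D).
Hypotheses (Mf : IsMMorphism f) (Mg : IsMMorphism g) (mg : Multiplicative g).

Lemma core Y W (t : W ~> _) :
  act (mul D) Y ∘ (wh D (act g.₁ Y) ∘ (wh D (act f.₁ (D ⊗ Y)) ∘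
     (act g.₂ _ ∘ t)))
  = act (mul D) Y ∘ (act g.₂ (D ⊗ Y) ∘ (wh D (act f.₂ (D ⊗ Y)) ∘
     (wh D (wh B (wh A (act g.₁ Y))) ∘ t))).
Proof.
have F := proj1 (act_square _ _ _ _) Mf.
have G := proj1 (act_square _ _ _ _) Mg.
have G2 := proj1 (act_square _ _ _ _) (eq_sym (proj2 mg)).
rewrite (tail (G Y)) -(tail (act_nat g.₂ (act f.₁ (D ⊗ Y)))).
rewrite -(tail (G2 _)) (wh_tail (F _)) (tail (G2 _)).
rewrite (wh_tail (act_nat f.₂ (act g.₁ Y))).
by rewrite (tail (act_nat g.₂ (act g.₁ Y))) (tail (G _)).
Qed.
End Core.

Section Composite.
Context (A : V) (B D : Magma V) (f : Components A B) (g : Components B D).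
Hypotheses (Mf : IsMMorphism f) (Mg : IsMMorphism g) (mg : Multiplicative g)
  (dg : Dense Q g) (nD : NonDegenerate D).

Lemma composite_unique (h h' : Components A D) :
  IsComposite g f h -> IsComposite g f h' -> h = h'.
Proof.
move=> [h1 h2] [h1' h2']; case: dg => d1 d2; apply: components_eq.
  apply: (Q_epi (Q_whl A d1)); apply: (Q_epi (Q_assoc _ _ _)).
  by rewrite h1 h1'.
by apply: (Q_epi (Q_whr _ d2)); rewrite h2 h2'.
Qed.

Lemma composite_fst :
  exists h : A ⊗ D ~> D, h ∘ (idm A ⊠ g.₁) ∘ α A B D = g.₁ ∘ (f.₁ ⊠ idm D).
Proof.
have [X [u [v [[euv _] /(_ A)[[_ up] _]]]]] := Q_coeq HQ (proj1 dg).
have [|h [hP _]] := up _ (g.₁ ∘ (f.₁ ⊠ idm D) ∘ αi A B D).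
  apply: (nondeg_act_l nD) => Y; rewrite !fst_tail !wh_comp.
  rewrite -!(comp_assoc _ _ (wh D (α A X Y))); congr (_ ∘ _).
  have Q2 : Q _ _ (act g.₂ (A ⊗ X ⊗ Y)) by apply: Q_act; exact: (proj2 dg).
  apply: (Q_epi Q2); rewrite !comp_assoc -!act_nat.
  by rewrite !(core Mf Mg mg) -!wh_comp (coact_eq Y euv).
by exists h; rewrite hP comp_assoc assocK comp_idr.
Qed.

Lemma composite_snd :
  exists h : D ⊗ A ~> D, h ∘ (g.₂ ⊠ idm A) = g.₂ ∘ (idm D ⊠ f.₂) ∘ α D B A.
Proof.
have [X [u [v [[euv _] /(_ A)[_ [_ up]]]]]] := Q_coeq HQ (proj2 dg).
have [|h [hP _]] := up _ (g.₂ ∘ (idm D ⊠ f.₂) ∘ α D B A); last by exists h.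
apply: (nondeg_act_r nD) => Y; rewrite !snd_tail.
rewrite -!(comp_assoc _ _ (α X A (D ⊗ Y))); congr (_ ∘ _).
have Q1 : Q _ _ (wh X (wh A (act g.₁ Y))).
  by do 2!apply: Q_wh; apply: Q_act; exact: (proj1 dg).
apply: (Q_epi Q1); rewrite !comp_assoc !coact_nat.
by rewrite -!(core Mf Mg mg) (coact_eq _ euv).
Qed.

Lemma composite_MMorphism (h : Components A D) :
  IsComposite g f h -> IsMMorphism h.
Proof.
move=> [h1 h2]; apply/act_square => Y.
have H1 := proj1 (act_square _ _ _ _) h1.
have H2 := proj1 (act_square _ _ _ _) (eq_sym h2).
have Q1 : Q _ _ (wh D (wh B (wh A (act g.₁ Y)))).
  by do 3!apply: Q_wh; apply: Q_act; exact: (proj1 dg).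
have Q2 : Q _ _ (act g.₂ (A ⊗ D ⊗ Y)) by apply: Q_act; exact: (proj2 dg).
apply: (Q_epi Q2); apply: (Q_epi Q1); rewrite !comp_assoc.
rewrite -[wh D (wh B _)]comp_idr -(tail (H2 _)) -(core Mf Mg mg) !comp_idr.
by rewrite act_nat -(wh_tail (H1 Y)).
Qed.

Lemma composite_Dense (h : Components A D) :
  Dense Q f -> IsComposite g f h -> Dense Q h.
Proof.
move=> [df1 df2] [h1 h2]; case: dg => dg1 dg2; split.
  apply: (Q_cancel HQ (s := (idm A ⊠ g.₁) ∘ α A B D)).
    by apply: (Q_comp HQ); [apply: Q_assoc | apply: Q_whl].
  by rewrite -comp_assoc h1; apply: (Q_comp HQ) => //; apply: Q_whr.
apply: (Q_cancel HQ (s := g.₂ ⊠ idm A)); first exact: Q_whr.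
rewrite h2; apply: (Q_comp HQ); first exact: Q_assoc.
by apply: (Q_comp HQ) => //; apply: Q_whl.
Qed.
End Composite.

Lemma composite_Multiplicative (A B D : Magma V) (f : Components A B)
    (g : Components B D) (h : Components A D) :
  Dense Q g -> Multiplicative f -> IsComposite g f h -> Multiplicative h.
Proof.
move=> [dg1 dg2] [f1 f2] [h1 h2].
have F1 := proj1 (act_square _ _ _ _) f1.
have F2 := proj1 (act_square _ _ _ _) (eq_sym f2).
have H1 := proj1 (act_square _ _ _ _) h1.
have H2 := proj1 (act_square _ _ _ _) (eq_sym h2).
split; last symmetry; apply/act_square => Y.
  apply: (Q_epi (Q_wh A (Q_wh A (Q_act Y dg1)))).
  rewrite !comp_assoc act_nat -wh_comp H1 (tail (H1 _)) wh_comp.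
  by rewrite (tail (H1 _)) F1.
apply: (Q_epi (Q_act (A ⊗ A ⊗ Y) dg2)).
rewrite !comp_assoc -act_nat -(tail (H2 Y)) -(H2 (A ⊗ Y)) -(tail (H2 Y)).
by rewrite -!wh_comp F2.
Qed.

Lemma id_MHom (A : Magma V) : IsMObject Q A -> IsMHom Q (idComponents A).
Proof.
move=> [sg [_ Qm]]; rewrite /IsMHom /IsMMorphism /Dense /Multiplicative /=.
by rewrite sg.
Qed.

Lemma id_composite_r (A B : Magma V) (f : Components A B) :
  Multiplicative f -> IsComposite f (idComponents A) f.
Proof. by []. Qed.

Lemma id_composite_l (A : V) (B : Magma V) (f : Components A B) :
  IsMMorphism f -> IsSemigroup B -> NonDegenerate B ->
  IsComposite (idComponents B) f f.
Proof.
move=> Mf sg nd; rewrite /IsComposite /=.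
have F := proj1 (act_square _ _ _ _) Mf.
have M := proj1 (act_square _ _ _ _) (eq_sym sg).
have Qi X Y Z : Q _ _ (αi X Y Z).
  apply: (Q_iso HQ); exists (α X Y Z).
  by split; [apply: assocKi | apply: assocK].
split.
  apply: (nondeg_act_l nd) => Y.
  apply: (Q_epi (Q_wh B (Qi (A ⊗ B) B Y))).
  apply: (Q_epi (Q_wh B (Qi A B (B ⊗ Y)))).
  rewrite -!whD !comp_assoc -!wh_comp -!comp_assoc.
  rewrite -act_square_r -act_square_l !wh_comp.
  by rewrite (tail (F Y)) (act_nat f.₂) !(tail (M Y)) F.
symmetry; apply: (nondeg_act_r nd) => Y.
apply: (Q_epi (Qi (B ⊗ B) A (B ⊗ Y))); apply: (Q_epi (Qi B B (A ⊗ B ⊗ Y))).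
rewrite -whD !(comp_assoc (act _ _)).
rewrite -act_square_r -act_square_l.
by rewrite -(tail (M Y)) -wh_comp -F -(tail (F Y)) -act_nat wh_comp !(tail (M Y)).
Qed.

Lemma composite_assoc (A : V) (B D E : Magma V) (f : Components A B)
    (g : Components B D) (k : Components D E) (gf : Components A D)
    (kg : Components B E) (h : Components A E) :
  Dense Q k -> IsComposite g f gf -> IsComposite k g kg ->
  IsComposite k gf h -> IsComposite kg f h.
Proof.
move=> [dk1 dk2] [gf1 gf2] [kg1 kg2] [h1 h2].
have GF1 := proj1 (act_square _ _ _ _) gf1.
have GF2 := proj1 (act_square _ _ _ _) (eq_sym gf2).
have KG1 := proj1 (act_square _ _ _ _) kg1.
have KG2 := proj1 (act_square _ _ _ _) (eq_sym kg2).
have H1 := proj1 (act_square _ _ _ _) h1.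
have H2 := proj1 (act_square _ _ _ _) (eq_sym h2).
split; last symmetry; apply/act_square => Y.
  apply: (Q_epi (Q_wh A (Q_wh B (Q_act Y dk1)))).
  rewrite !comp_assoc act_nat -wh_comp KG1 (tail (KG1 _)) wh_comp.
  by rewrite (tail (H1 _)) GF1.
apply: (Q_epi (Q_act (B ⊗ A ⊗ Y) dk2)).
rewrite !comp_assoc -act_nat -(tail (KG2 Y)) -(KG2 (A ⊗ Y)) -(tail (H2 Y)).
by rewrite -!wh_comp GF2.
Qed.

Lemma composite_exists (A B D : MObject Q) (g : MHom B D) (f : MHom A B) :
  exists h : MHom A D, IsComposite g f h.
Proof.
case: f => f [Mf [df mf]]; case: g => g [Mg [dg mg]] /=.
have [_ [nD _]] := mob_ax D.
have [h1 e1] := composite_fst Mf Mg mg dg nD.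
have [h2 e2] := composite_snd Mf Mg mg dg nD.
pose h := {| fst_ := h1; snd_ := h2 |} : Components A D.
have hc : IsComposite g f h by split.
have hP : IsMHom Q h.
  split; first exact: (composite_MMorphism Mf Mg mg dg hc).
  split; first exact: (composite_Dense dg df hc).
  exact: (composite_Multiplicative dg mf hc).
by exists {| mhom := h; mhom_ax := hP |}.
Qed.

(* The choice is immaterial: by composite_unique the components are determined,
   and by MHom_eq so is the morphism. *)
Definition compM (A B D : MObject Q) (g : MHom B D) (f : MHom A B) : MHom A D :=
  proj1_sig (constructive_indefinite_description _ (composite_exists g f)).

Definition idM (A : MObject Q) : MHom A A :=
  {| mhom := idComponents A; mhom_ax := id_MHom (mob_ax A) |}.

Lemma compMP (A B D : MObject Q) (g : MHom B D) (f : MHom A B) :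
  IsComposite g f (compM g f).
Proof. by rewrite /compM; case: constructive_indefinite_description. Qed.

(* Among all components, not only those of morphisms of M. *)
Lemma compM_unique (A B D : MObject Q) (g : MHom B D) (f : MHom A B)
    (h : Components A D) : IsComposite g f h -> h = compM g f.
Proof.
have [_ [dg _]] := mhom_ax g.
by move=> hc; apply: (composite_unique dg hc (compMP g f)).
Qed.

Lemma compM_idl (A B : MObject Q) (f : MHom A B) : compM (idM B) f = f.
Proof.
apply: MHom_eq; symmetry; apply: compM_unique.
have [Mf _] := mhom_ax f; have [sg [nd _]] := mob_ax B.
exact: id_composite_l.
Qed.

Lemma compM_idr (A B : MObject Q) (f : MHom A B) : compM f (idM A) = f.
Proof.
apply: MHom_eq; symmetry; apply: compM_unique.
by have [_ [_ mf]] := mhom_ax f; apply: id_composite_r.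
Qed.

Lemma compM_assoc (A B D E : MObject Q) (k : MHom D E) (g : MHom B D)
    (f : MHom A B) : compM (compM k g) f = compM k (compM g f).
Proof.
apply: MHom_eq; symmetry; apply: compM_unique; have [_ [dk _]] := mhom_ax k.
exact: (composite_assoc dk (compMP g f) (compMP k g) (compMP k (compM g f))).
Qed.

Definition catM : Category := {|
  Ob := MObject Q;
  Hom := @MHom V Q;
  idm := idM;
  comp := compM;
  comp_idl := compM_idl;
  comp_idr := compM_idr;
  comp_assoc := compM_assoc
|}.

End Composition.

Section Monoidal.
Context (V : BraidedMonoidalCategory).

(* 1c1 : A B D E ~> A D B E *)
Definition mid (A B D E : V) : (A ⊗ B) ⊗ (D ⊗ E) ~> (A ⊗ D) ⊗ (B ⊗ E) :=
  αi A D (B ⊗ E)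
    ∘ (idm A ⊠ (α D B E ∘ (braid B D ⊠ idm E) ∘ αi B D E))
    ∘ α A B (D ⊗ E).

Definition prodMagma (A B : Magma V) : Magma V :=
  {| car := A ⊗ B; mul := (mul A ⊠ mul B) ∘ mid A B A B |}.

Definition unitMagma : Magma V := {| car := 𝟙; mul := λ 𝟙 |}.

Definition prodComponents (A A' B B' : Magma V)
    (f : Components A B) (f' : Components A' B')
  : Components (prodMagma A A') (prodMagma B B') :=
  @Build_Components V (prodMagma A A') (prodMagma B B')
    ((f.₁ ⊠ f'.₁) ∘ mid A A' B B')
    ((f.₂ ⊠ f'.₂) ∘ mid B B' A A').

Section Data.
Context (Q : MorphismClass V) (HQ : Admissible Q).

(* Objects and morphisms of M are data (Magma, Components) satisfying a
   predicate, so that a monoidal product given on the data defines one on M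
   exactly when it respects the predicates, as recorded here. *)
Record MonoidalClosure : Prop := {
  prod_obj : forall A B : MObject Q, IsMObject Q (prodMagma A B);
  unit_obj : IsMObject Q unitMagma;
  prod_hom : forall (A A' B B' : MObject Q) (f : MHom A B) (f' : MHom A' B'),
    IsMHom Q (prodComponents f f');
  assoc_hom : forall A B D : MObject Q,
    IsMHom Q (sharp (prodMagma (prodMagma A B) D)
                    (prodMagma A (prodMagma B D)) (α A B D));
  assoc_inv_hom : forall A B D : MObject Q,
    IsMHom Q (sharp (prodMagma A (prodMagma B D))
                    (prodMagma (prodMagma A B) D) (αi A B D));
  lunit_hom : forall A : MObject Q,
    IsMHom Q (sharp (prodMagma unitMagma A) A (λ A));
  lunit_inv_hom : forall A : MObject Q,
    IsMHom Q (sharp A (prodMagma unitMagma A) (λi A));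
  runit_hom : forall A : MObject Q,
    IsMHom Q (sharp (prodMagma A unitMagma) A (ρ A));
  runit_inv_hom : forall A : MObject Q,
    IsMHom Q (sharp A (prodMagma A unitMagma) (ρi A))
}.

Context (K : MonoidalClosure).

Definition prodM (A B : catM HQ) : catM HQ :=
  {| mob := prodMagma A B; mob_ax := prod_obj K A B |}.
Definition unitM : catM HQ :=
  {| mob := unitMagma; mob_ax := unit_obj K |}.

Definition monoidalDataM : MonoidalData (catM HQ) := {|
  tensO := prodM;
  tensM := fun (A A' B B' : catM HQ) (f : A ~> A') (g : B ~> B') =>
    @Build_MHom V Q (prodM A B) (prodM A' B')
      (prodComponents f g) (prod_hom K f g);
  unitO := unitM;
  assoc := fun A B D : catM HQ =>
    @Build_MHom V Q (prodM (prodM A B) D) (prodM A (prodM B D))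
      (sharp (prodM (prodM A B) D) (prodM A (prodM B D)) (α A B D)) (assoc_hom K A B D);
  assoc_inv := fun A B D : catM HQ =>
    @Build_MHom V Q (prodM A (prodM B D)) (prodM (prodM A B) D)
      (sharp (prodM A (prodM B D)) (prodM (prodM A B) D) (αi A B D)) (assoc_inv_hom K A B D);
  lunit := fun A : catM HQ =>
    @Build_MHom V Q (prodM unitM A) A
      (sharp (prodM unitM A) A (λ A)) (lunit_hom K A);
  lunit_inv := fun A : catM HQ =>
    @Build_MHom V Q A (prodM unitM A)
      (sharp A (prodM unitM A) (λi A)) (lunit_inv_hom K A);
  runit := fun A : catM HQ =>
    @Build_MHom V Q (prodM A unitM) A
      (sharp (prodM A unitM) A (ρ A)) (runit_hom K A);
  runit_inv := fun A : catM HQ =>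
    @Build_MHom V Q A (prodM A unitM)
      (sharp A (prodM A unitM) (ρi A)) (runit_inv_hom K A)
|}.
End Data.
End Monoidal.

(* Main.v *)
From Stdlib Require Import ssreflect.
Require Import Defs.

Set Implicit Arguments.
Unset Strict Implicit.
Unset Printing Implicit Defensive.

(** Every axiom of the monoidal category M becomes, once the composites in M
    are characterized by their two defining equations, a statement about a few
    morphisms of the underlying braided category.  Three ingredients suffice.

    First, multiplications and components of products all have the form
    [box f f'], that is f ⊠ f' preceded by the interchange [mid] = 1c1.  The
    interchange makes the tensor product of a braided category a monoidal
    functor, so it satisfies an associativity law ([mid_assoc]).  Associativity
    of a semigroup, the condition on an M-morphism, multiplicativity and the
    equations of a composite are all squares s.1r = q.p1, and [mid_assoc] gives
    one lemma ([box_square]) saying that the products of two such squares are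
    again such a square.  It settles products of objects, of morphisms and of
    composites.  The interchange is moreover compatible with associativity and
    unit isomorphisms ([box_assoc], [box_lunit], [box_runit]); this says both
    that these are semigroup homomorphisms and that they are natural.

    Second, the product of non-degenerate semigroups is non-degenerate: up to
    braidings, multiplying by A B on the right is multiplying by B and then,
    after moving the result past A by the invertible braiding, by A
    ([prod_mul_right], [prod_mul_left]).

    Third, f |-> f^# is functorial on homomorphisms ([sharp_composite]),
    compatible with products ([prodComponents_sharp]), and turns commutation
    with the components of M-morphisms into commutation in M
    ([sharp_natural]).  Hence the coherence laws, which hold for the constraints
    of the underlying category, pass to their images in M.

    The identities between braidings are proved in a strict setting: an object
    A is replaced by the functor A ⊗ -, and an iterated product of objects by
    the composite functor, so that associativity and unit isomorphisms become
    identities. *)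

(** * Preliminaries on monoidal categories *)

Section Tensor.
Context (V : MonoidalCategory).
Implicit Types A B D X Y Z : V.

Let T := mc_ax V.

Lemma tensr_comp A X Y Z (g : Y ~> Z) (f : X ~> Y) :
  idm A ⊠ (g ∘ f) = (idm A ⊠ g) ∘ (idm A ⊠ f).
Proof. by rewrite -(tens_comp T) comp_idl. Qed.

Lemma tensl_comp A X Y Z (g : Y ~> Z) (f : X ~> Y) :
  (g ∘ f) ⊠ idm A = (g ⊠ idm A) ∘ (f ⊠ idm A).
Proof. by rewrite -(tens_comp T) comp_idl. Qed.

Lemma tens_slide A A' B B' (f : A ~> A') (g : B ~> B') :
  (f ⊠ idm B') ∘ (idm A ⊠ g) = (idm A' ⊠ g) ∘ (f ⊠ idm B).
Proof. by rewrite -!(tens_comp T) !comp_idl !comp_idr. Qed.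

Lemma lunit_faithful X Y (f g : X ~> Y) : idm 𝟙 ⊠ f = idm 𝟙 ⊠ g -> f = g.
Proof.
move=> e; case: (lunit_iso T X) => _ e2.
rewrite -[f]comp_idr -[g]comp_idr -e2 -!comp_assoc.
by rewrite -!(lunit_nat T) e.
Qed.

Lemma iso_epi (X Y Z : V) (q : X ~> Y) (q' : Y ~> X) (f g : Y ~> Z) :
  q ∘ q' = idm Y -> f ∘ q = g ∘ q -> f = g.
Proof.
by move=> e /(f_equal (fun z => z ∘ q')); rewrite !comp_assoc e !comp_idr.
Qed.

Lemma iso_mono (X Y Z : V) (q : Y ~> Z) (q' : Z ~> Y) (f g : X ~> Y) :
  q' ∘ q = idm Y -> q ∘ f = q ∘ g -> f = g.
Proof.
move=> e /(f_equal (fun z => q' ∘ z)).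
by rewrite -!comp_assoc e !comp_idl.
Qed.

(** Kelly's lemma: this unit law is a consequence of the pentagon and the
    triangle, obtained by cancelling a further factor I on the left. *)
Lemma lunit_assoc A B : λ (A ⊗ B) ∘ α 𝟙 A B = λ A ⊠ idm B.
Proof.
apply: lunit_faithful; apply: (iso_epi (assocKi _ _ _)).
apply: (@iso_epi _ _ _ (α 𝟙 𝟙 A ⊠ idm B) (αi 𝟙 𝟙 A ⊠ idm B)).
  by rewrite -tensl_comp assocKi (tens_id T).
rewrite tensr_comp !comp_assoc -(comp_assoc (idm 𝟙 ⊠ α 𝟙 A B)).
rewrite -(pentagon T) -comp_assoc (triangle T).
rewrite -(comp_assoc (idm 𝟙 ⊠ _)) -(assoc_nat T) comp_assoc -tensl_comp.
by rewrite (triangle T) (assoc_nat T) (tens_id T).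
Qed.

End Tensor.

(** * Flattening: strict computation with braidings *)

Section Flattening.
Context (V : BraidedMonoidalCategory).
Implicit Types A B D X Y Z : V.

Let T := mc_ax V.

(** A word records how an object is built by tensor products and units; [ob]
    is the object itself, and [ap] is the strict version of tensoring with it,
    where all brackets are moved to the right and the units are dropped. *)
Inductive word := Leaf of V | Unit | Prod of word & word.
Implicit Types s t u : word.

Fixpoint ob s : V :=
  match s with Leaf A => A | Unit => 𝟙 | Prod s t => ob s ⊗ ob t end.

Fixpoint ap s X : V :=
  match s with Leaf A => A ⊗ X | Unit => X | Prod s t => ap s (ap t X) end.

Fixpoint apm s X Y (f : X ~> Y) : ap s X ~> ap s Y :=
  match s with
  | Leaf A => idm A ⊠ f
  | Unit => f
  | Prod s t => apm s (apm t f)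
  end.

Fixpoint norm s X : ob s ⊗ X ~> ap s X :=
  match s with
  | Leaf A => idm (A ⊗ X)
  | Unit => λ X
  | Prod s t => norm s (ap t X) ∘ (idm (ob s) ⊠ norm t X) ∘ α (ob s) (ob t) X
  end.

Fixpoint norm_inv s X : ap s X ~> ob s ⊗ X :=
  match s with
  | Leaf A => idm (A ⊗ X)
  | Unit => λi X
  | Prod s t =>
      αi (ob s) (ob t) X ∘ (idm (ob s) ⊠ norm_inv t X) ∘ norm_inv s (ap t X)
  end.

Lemma normK s X : norm_inv s X ∘ norm s X = idm _.
Proof.
elim: s X => [A | | s IHs t IHt] X /=; first by rewrite comp_idl.
  by case: (lunit_iso T X).
rewrite !comp_assoc -(comp_assoc (norm_inv s _)) IHs comp_idl.
by rewrite -(comp_assoc (idm _ ⊠ _)) -tensr_comp IHt (tens_id T) comp_idl assocK.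
Qed.

Lemma normKi s X : norm s X ∘ norm_inv s X = idm _.
Proof.
elim: s X => [A | | s IHs t IHt] X /=; first by rewrite comp_idl.
  by case: (lunit_iso T X).
rewrite !comp_assoc -(comp_assoc (α _ _ _)) assocKi comp_idl.
by rewrite -(comp_assoc (idm _ ⊠ _)) -tensr_comp IHt (tens_id T) comp_idl IHs.
Qed.

Lemma norm_nat s X Y (f : X ~> Y) :
  apm s f ∘ norm s X = norm s Y ∘ (idm (ob s) ⊠ f).
Proof.
elim: s X Y f => [A | | s IHs t IHt] X Y f /=.
    by rewrite comp_idl comp_idr.
  by rewrite (lunit_nat T).
rewrite -!comp_assoc IHs !comp_assoc; congr (_ ∘ _).
rewrite -!comp_assoc -tensr_comp IHt tensr_comp !comp_assoc; congr (_ ∘ _).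
by rewrite -(assoc_nat T) (tens_id T).
Qed.

Lemma apm_id s X : apm s (idm X) = idm _.
Proof.
by elim: s X => [A | | s IHs t IHt] X //=; rewrite ?(tens_id T) // IHt.
Qed.

(** F is the transformation A1 ⊗ (A2 ⊗ ... X) ~> B1 ⊗ (B2 ⊗ ... X) induced by
    f.  As a relation, it lets F be given in any convenient form: the closure
    lemmas below build it without associativity or unit isomorphisms. *)
Definition flattens s t (f : ob s ~> ob t) (F : forall X, ap s X ~> ap t X) :=
  forall X, F X ∘ norm s X = norm t X ∘ (f ⊠ idm X).

(** An equation of morphisms may be checked on flattenings, because tensoring
    with the unit object is faithful. *)
Lemma flattens_inj s t (f g : ob s ~> ob t) F G :
  flattens f F -> flattens g G -> (forall X, F X = G X) -> f = g.
Proof.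
move=> fF gG FG; apply: unit_faithful.
rewrite -[LHS]comp_idl -[RHS]comp_idl -(normK t) !comp_assoc.
by rewrite -fF -gG FG.
Qed.

Lemma flattens_uniq s t (f g : ob s ~> ob t) F G :
  flattens f F -> flattens g G -> f = g -> forall X, F X = G X.
Proof.
move=> fF gG fg X; apply: (iso_epi (normKi s X)).
by rewrite fF gG fg.
Qed.

Lemma flattens_nat s t (f : ob s ~> ob t) F : flattens f F ->
  forall X Y (x : X ~> Y), F Y ∘ apm s x = apm t x ∘ F X.
Proof.
move=> fF X Y x; apply: (iso_epi (normKi s X)).
rewrite !comp_assoc norm_nat fF -!comp_assoc fF norm_nat !comp_assoc.
by rewrite tens_slide.
Qed.

(* Locked, so that the flattening of an atomic morphism stays atomic when the
   flattenings of words are computed. *)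
Fact lift_key : unit. Proof. exact tt. Qed.
Definition lift s t (f : ob s ~> ob t) X : ap s X ~> ap t X :=
  locked_with lift_key (norm t X ∘ (f ⊠ idm X) ∘ norm_inv s X).

Lemma lift_flattens s t (f : ob s ~> ob t) : flattens f (lift f).
Proof. by move=> X; rewrite /lift locked_withE !comp_assoc normK comp_idr. Qed.

Lemma id_flattens s : flattens (idm (ob s)) (fun X => idm (ap s X)).
Proof. by move=> X; rewrite (tens_id T) comp_idl comp_idr. Qed.

Lemma comp_flattens s t u (g : ob t ~> ob u) (f : ob s ~> ob t) G F :
  flattens g G -> flattens f F -> flattens (g ∘ f) (fun X => G X ∘ F X).
Proof.
by move=> gG fF X; rewrite comp_assoc fF -comp_assoc gG tensl_comp !comp_assoc.
Qed.

Lemma tens_flattens s s' t t' (f : ob s ~> ob s') (g : ob t ~> ob t') F G :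
  flattens f F -> flattens g G ->
  flattens (s := Prod s t) (t := Prod s' t') (f ⊠ g)
    (fun X => F (ap t' X) ∘ apm s (G X)).
Proof.
move=> fF gG X /=.
rewrite !comp_assoc (assoc_nat T) -!comp_assoc; congr (_ ∘ _).
rewrite (comp_assoc (F _)) norm_nat -comp_assoc fF !comp_assoc.
by congr (_ ∘ _); rewrite -!(tens_comp T) !comp_idl gG comp_idr.
Qed.

(** This is the pentagon. *)
Lemma assoc_flattens s t u :
  flattens (s := Prod (Prod s t) u) (t := Prod s (Prod t u))
    (α (ob s) (ob t) (ob u)) (fun X => idm _).
Proof.
move=> X /=; rewrite comp_idl !tensr_comp !comp_assoc; congr (_ ∘ _).
rewrite -(comp_assoc (idm _ ⊠ α _ _ _)) -(pentagon T) -!comp_assoc; congr (_ ∘ _).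
rewrite !comp_assoc -(tens_id T); congr (_ ∘ _).
by rewrite (assoc_nat T).
Qed.

Lemma lunit_flattens s :
  flattens (s := Prod Unit s) (t := s) (λ (ob s)) (fun X => idm _).
Proof.
by move=> X /=; rewrite comp_idl (lunit_nat T) comp_assoc lunit_assoc.
Qed.

(** This is the triangle. *)
Lemma runit_flattens s :
  flattens (s := Prod s Unit) (t := s) (ρ (ob s)) (fun X => idm _).
Proof. by move=> X /=; rewrite comp_idl comp_assoc (triangle T). Qed.

Lemma inv_flattens s t (f : ob s ~> ob t) (g : ob t ~> ob s) F G :
  f ∘ g = idm _ -> (forall X, G X ∘ F X = idm _) ->
  flattens f F -> flattens g G.
Proof.
move=> fg GF fF X; rewrite -[RHS]comp_idl -GF comp_assoc -(comp_assoc (F X)) fF.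
by rewrite !comp_assoc -tensl_comp fg (tens_id T) comp_idr.
Qed.

Lemma assoc_inv_flattens s t u :
  flattens (s := Prod s (Prod t u)) (t := Prod (Prod s t) u)
    (αi (ob s) (ob t) (ob u)) (fun X => idm _).
Proof.
apply: (inv_flattens _ _ (assoc_flattens s t u)); first exact: assocKi.
by move=> X; rewrite comp_idl.
Qed.

Lemma flattens_eq s t (f g : ob s ~> ob t) F G :
  flattens f F -> f = g -> (forall X, F X = G X) -> flattens g G.
Proof. by move=> fF <- FG X; rewrite -FG fF. Qed.

(** The braiding with the unit is trivial: flattened, the hexagon for a, I, I
    reads c = c.c, where naturality along I I ~> I identifies the braiding of a
    with I I and the one with I; as c is invertible, it is an identity. *)
Lemma braid_unit_r a :
  flattens (s := Prod a Unit) (t := Prod Unit a) (braid (ob a) 𝟙)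
    (fun X => idm _).
Proof.
pose cA := @lift (Prod a Unit) (Prod Unit a) (braid (ob a) 𝟙).
have fc : flattens _ cA := lift_flattens _.
pose cU := @lift (Prod a (Prod Unit Unit)) (Prod (Prod Unit Unit) a)
  (braid (ob a) (𝟙 ⊗ 𝟙)).
have fU : flattens _ cU := lift_flattens _.
have nat X : cU X = cA X.
  have := flattens_uniq
    (comp_flattens (tens_flattens (lunit_flattens Unit) (id_flattens a)) fU)
    (comp_flattens fc (tens_flattens (id_flattens a) (lunit_flattens Unit))).
  move=> /(_ (eq_sym (braid_nat (idm (ob a)) (λ 𝟙))) X) /=.
  by rewrite ?apm_id !comp_idl comp_idr.
have hex X : cU X = cA X ∘ cA X.
  have := flattens_uniq
    (comp_flattens (comp_flattens (assoc_flattens Unit Unit a) fU)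
       (assoc_flattens a Unit Unit))
    (comp_flattens (comp_flattens (tens_flattens (id_flattens Unit) fc)
       (assoc_flattens Unit a Unit)) (tens_flattens fc (id_flattens Unit)))
    (hexagon1 (ob a) 𝟙 𝟙) X.
  by rewrite /= ?apm_id !comp_idl !comp_idr.
have [ci [_ ciK]] := braid_iso (ob a) 𝟙.
pose ciA := @lift (Prod Unit a) (Prod a Unit) ci.
have cK X : cA X ∘ ciA X = idm _.
  have := flattens_uniq
    (comp_flattens fc (lift_flattens (s := Prod Unit a) (t := Prod a Unit) ci))
    (id_flattens (Prod Unit a)).
  by move=> /(_ ciK X).
apply: (flattens_eq fc) => // X.
by apply: (iso_epi (cK X)); rewrite -hex nat comp_idl.
Qed.

Lemma braid_unit_l a :
  flattens (s := Prod Unit a) (t := Prod a Unit) (braid 𝟙 (ob a))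
    (fun X => idm _).
Proof.
pose cA := @lift (Prod Unit a) (Prod a Unit) (braid 𝟙 (ob a)).
have fc : flattens _ cA := lift_flattens _.
pose cU := @lift (Prod (Prod Unit Unit) a) (Prod a (Prod Unit Unit))
  (braid (𝟙 ⊗ 𝟙) (ob a)).
have fU : flattens _ cU := lift_flattens _.
have nat X : cU X = cA X.
  have := flattens_uniq
    (comp_flattens (tens_flattens (id_flattens a) (lunit_flattens Unit)) fU)
    (comp_flattens fc (tens_flattens (lunit_flattens Unit) (id_flattens a))).
  move=> /(_ (eq_sym (braid_nat (λ 𝟙) (idm (ob a)))) X) /=.
  by rewrite ?apm_id !comp_idl comp_idr.
have hex X : cU X = cA X ∘ cA X.
  have := flattens_uniq
    (comp_flattens (comp_flattens (assoc_inv_flattens a Unit Unit) fU)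
       (assoc_inv_flattens Unit Unit a))
    (comp_flattens (comp_flattens (tens_flattens fc (id_flattens Unit))
       (assoc_inv_flattens Unit a Unit)) (tens_flattens (id_flattens Unit) fc))
    (hexagon2 𝟙 𝟙 (ob a)) X.
  by rewrite /= ?apm_id !comp_idl !comp_idr.
have [ci [_ ciK]] := @braid_iso V 𝟙 (ob a).
pose ciA := @lift (Prod a Unit) (Prod Unit a) ci.
have cK X : cA X ∘ ciA X = idm _.
  have := flattens_uniq
    (comp_flattens fc (lift_flattens (s := Prod a Unit) (t := Prod Unit a) ci))
    (id_flattens (Prod a Unit)).
  by move=> /(_ ciK X).
apply: (flattens_eq fc) => // X.
by apply: (iso_epi (cK X)); rewrite -hex nat comp_idl.
Qed.

Definition swap A B X : A ⊗ B ⊗ X ~> B ⊗ A ⊗ X :=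
  @lift (Prod (Leaf A) (Leaf B)) (Prod (Leaf B) (Leaf A)) (braid A B) X.

(** [swap_leaf] and [swaps] are the expansions of the braiding of two words into
    braidings of single letters given by the hexagons. *)
Fixpoint swap_leaf A t X : A ⊗ ap t X ~> ap t (A ⊗ X) :=
  match t with
  | Leaf B => swap A B X
  | Unit => idm (A ⊗ X)
  | Prod t1 t2 => apm t1 (swap_leaf A t2 X) ∘ swap_leaf A t1 (ap t2 X)
  end.

Fixpoint swaps s t X : ap s (ap t X) ~> ap t (ap s X) :=
  match s with
  | Leaf A => swap_leaf A t X
  | Unit => idm (ap t X)
  | Prod s1 s2 => swaps s1 t (ap s2 X) ∘ apm s1 (swaps s2 t X)
  end.

Lemma braid_tens_r A B D :
  αi B D A ∘ ((idm B ⊠ braid A D) ∘ α B A D ∘ (braid A B ⊠ idm D)) ∘ αi A B D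
    = braid A (B ⊗ D).
Proof.
rewrite -hexagon1 -!comp_assoc assocK comp_idl.
by rewrite comp_assoc assocKi comp_idr.
Qed.

Lemma braid_tens_l A B D :
  α D A B ∘ ((braid A D ⊠ idm B) ∘ αi A D B ∘ (idm A ⊠ braid B D)) ∘ α A B D
    = braid (A ⊗ B) D.
Proof.
rewrite -hexagon2 -!comp_assoc assocKi comp_idl.
by rewrite comp_assoc assocK comp_idr.
Qed.

Lemma braid_leaf_flattens A t :
  flattens (s := Prod (Leaf A) t) (t := Prod t (Leaf A)) (braid A (ob t))
    (swap_leaf A t).
Proof.
elim: t => [B | | t1 IH1 t2 IH2]; first exact: lift_flattens.
  exact: (braid_unit_r (Leaf A)).
have e := @comp_flattens (Prod (Leaf A) (Prod t1 t2)) _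
  (Prod (Prod t1 t2) (Leaf A)) _ _ _ _
  (comp_flattens (assoc_inv_flattens _ _ _)
    (comp_flattens (comp_flattens (tens_flattens (id_flattens t1) IH2)
       (assoc_flattens _ _ _)) (tens_flattens IH1 (id_flattens t2))))
  (assoc_inv_flattens _ _ _).
apply: (flattens_eq e) => [|X]; first exact: braid_tens_r.
by rewrite /= !apm_id (tens_id T) !comp_idl !comp_idr.
Qed.

Lemma braid_flattens s t :
  flattens (s := Prod s t) (t := Prod t s) (braid (ob s) (ob t)) (swaps s t).
Proof.
elim: s => [A | | s1 IH1 s2 IH2]; first exact: braid_leaf_flattens.
  exact: braid_unit_l.
have e := @comp_flattens (Prod (Prod s1 s2) t) _ (Prod t (Prod s1 s2)) _ _ _ _
  (comp_flattens (assoc_flattens _ _ _)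
    (comp_flattens (comp_flattens (tens_flattens IH1 (id_flattens s2))
       (assoc_inv_flattens _ _ _)) (tens_flattens (id_flattens s1) IH2)))
  (assoc_flattens _ _ _).
apply: (flattens_eq e) => [|X]; first exact: braid_tens_l.
by rewrite /= !apm_id !comp_idl !comp_idr.
Qed.

Lemma swaps_nat_r s t t' (f : ob t ~> ob t') F X : flattens f F ->
  swaps s t' X ∘ apm s (F X) = F (ap s X) ∘ swaps s t X.
Proof.
move=> fF.
have := flattens_uniq
  (comp_flattens (braid_flattens s t') (tens_flattens (id_flattens s) fF))
  (comp_flattens (tens_flattens fF (id_flattens s)) (braid_flattens s t))
  (braid_nat (idm (ob s)) f) X.
by rewrite /= apm_id comp_idl comp_idr.
Qed.

Lemma swaps_nat_l s s' t (f : ob s ~> ob s') F X : flattens f F ->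
  swaps s' t X ∘ F (ap t X) = apm t (F X) ∘ swaps s t X.
Proof.
move=> fF.
have := flattens_uniq
  (comp_flattens (braid_flattens s' t) (tens_flattens fF (id_flattens t)))
  (comp_flattens (tens_flattens (id_flattens t) fF) (braid_flattens s t))
  (braid_nat f (idm (ob t))) X.
by rewrite /= apm_id comp_idl comp_idr.
Qed.

Lemma swap_nat A B X Y (x : X ~> Y) :
  swap A B Y ∘ (idm A ⊠ (idm B ⊠ x)) = (idm B ⊠ (idm A ⊠ x)) ∘ swap A B X.
Proof. exact: (flattens_nat (braid_flattens (Leaf A) (Leaf B)) x). Qed.

End Flattening.

(** [flatten V at W] replaces an equation in V by the equation of flattenings at
    W.  The flattening is read off from the term: [reify_mor] assembles the
    closure lemmas, [reify_ob] the words, and any morphism without visible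
    structure is an atom, flattened by [lift]. *)
Ltac reify_ob V A :=
  lazymatch A with
  | @tensO _ _ ?A ?B =>
    let a := reify_ob V A in let b := reify_ob V B in constr:(Prod a b)
  | @unitO _ _ => constr:(Unit V)
  | _ => constr:(@Leaf V A)
  end.

Ltac reify_mor V f :=
  lazymatch f with
  | @comp _ _ _ _ ?g ?f =>
    let p := reify_mor V g in let q := reify_mor V f in
    constr:(comp_flattens p q)
  | @tensM _ _ _ _ _ _ ?f ?g =>
    let p := reify_mor V f in let q := reify_mor V g in
    constr:(tens_flattens p q)
  | @idm _ ?A =>
    let a := reify_ob V A in constr:(id_flattens a)
  | @assoc _ _ ?A ?B ?D =>
    let a := reify_ob V A in let b := reify_ob V B in let d := reify_ob V D in
    constr:(assoc_flattens a b d)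
  | @assoc_inv _ _ ?A ?B ?D =>
    let a := reify_ob V A in let b := reify_ob V B in let d := reify_ob V D in
    constr:(assoc_inv_flattens a b d)
  | @lunit _ _ ?A => let a := reify_ob V A in constr:(lunit_flattens a)
  | @runit _ _ ?A => let a := reify_ob V A in constr:(runit_flattens a)
  | @braid _ ?A ?B =>
    let a := reify_ob V A in let b := reify_ob V B in
    constr:(braid_flattens a b)
  | _ =>
    lazymatch type of f with
    | @Hom _ ?A ?B =>
      let a := reify_ob V A in let b := reify_ob V B in
      constr:(@lift_flattens V a b f)
    end
  end.

Tactic Notation "flatten" constr(V) "at" ident(W) :=
  lazymatch goal with
  | |- ?f = ?g =>
    let p := reify_mor V f in let q := reify_mor V g in
    apply: (flattens_inj p q);
    cbn [ap apm swaps swap_leaf];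
    move=> W;
    rewrite ?(tens_id (mc_ax V)) ?comp_idl ?comp_idr ?comp_assoc
  end.

Ltac flatten_in V X e :=
  lazymatch type of e with
  | ?f = ?g =>
    let p := reify_mor V f in let q := reify_mor V g in
    move: (flattens_uniq p q e X);
    cbn [ap apm swaps swap_leaf];
    rewrite ?(tens_id (mc_ax V)) ?comp_idl ?comp_idr ?comp_assoc;
    clear e; move=> e
  end.

(** * The interchange 1c1 *)

Section Interchange.
Context (V : BraidedMonoidalCategory).
Implicit Types A B D E F : V.

Let T := mc_ax V.

Definition box A B D A' B' D' (f : A ⊗ B ~> D) (f' : A' ⊗ B' ~> D') :
    (A ⊗ A') ⊗ (B ⊗ B') ~> D ⊗ D' :=
  (f ⊠ f') ∘ mid A A' B B'.

Lemma mid_nat A A' B B' D D' E E' (f : A ~> A') (g : B ~> B') (h : D ~> D')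
    (k : E ~> E') :
  mid A' B' D' E' ∘ ((f ⊠ g) ⊠ (h ⊠ k)) = ((f ⊠ h) ⊠ (g ⊠ k)) ∘ mid A B D E.
Proof.
rewrite /mid !comp_assoc (assoc_nat T) -!comp_assoc -assoc_inv_nat.
congr (_ ∘ _); rewrite !comp_assoc; congr (_ ∘ _).
rewrite -!(tens_comp T) comp_idl comp_idr; congr (_ ⊠ _).
rewrite !comp_assoc assoc_inv_nat -!comp_assoc -(assoc_nat T).
congr (_ ∘ _); rewrite !comp_assoc -!(tens_comp T); congr (_ ∘ _).
by rewrite braid_nat comp_idl comp_idr.
Qed.

(** Both sides permute A A' B B' D D' into A B D A' B' D' by the same three
    braidings A'B, B'D and A'D; the first two act on different letters and are
    performed in opposite orders. *)
Lemma mid_assoc A A' B B' D D' :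
  (α A B D ⊠ α A' B' D') ∘ mid (A ⊗ B) (A' ⊗ B') D D'
      ∘ (mid A A' B B' ⊠ idm (D ⊗ D'))
    = mid A A' (B ⊗ D) (B' ⊗ D') ∘ (idm (A ⊗ A') ⊠ mid B B' D D')
      ∘ α (A ⊗ A') (B ⊗ B') (D ⊗ D').
Proof.
rewrite /mid; flatten V at W; rewrite !tensr_comp !comp_assoc.
by rewrite -!tensr_comp swap_nat.
Qed.

(** Compatibility with the associativity isomorphism; again three braidings,
    two of which are exchanged. *)
Lemma mid_tens_assoc A A' B B' D D' :
  α (A ⊗ A') (B ⊗ B') (D ⊗ D') ∘ (mid A B A' B' ⊠ idm (D ⊗ D'))
      ∘ mid (A ⊗ B) D (A' ⊗ B') D'
    = (idm (A ⊗ A') ⊠ mid B D B' D') ∘ mid A (B ⊗ D) A' (B' ⊗ D')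
      ∘ (α A B D ⊠ α A' B' D').
Proof.
rewrite /mid; flatten V at W; rewrite !tensr_comp -!comp_assoc.
by rewrite -!tensr_comp swap_nat.
Qed.

Lemma mid_lunit A A' :
  λ (A ⊗ A') ∘ (λ 𝟙 ⊠ idm (A ⊗ A')) ∘ mid 𝟙 A 𝟙 A' = λ A ⊠ λ A'.
Proof. by rewrite /mid; flatten V at W. Qed.

Lemma mid_runit A A' :
  ρ (A ⊗ A') ∘ (idm (A ⊗ A') ⊠ λ 𝟙) ∘ mid A 𝟙 A' 𝟙 = ρ A ⊠ ρ A'.
Proof. by rewrite /mid; flatten V at W; rewrite (tens_id T). Qed.

(** For multiplications p, q, r this says that α is a homomorphism between the
    products, for components of M-morphisms that it is natural; likewise for
    the unit isomorphisms below. *)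
Lemma box_assoc A B D A' B' D' E F G
    (p : A ⊗ A' ~> E) (q : B ⊗ B' ~> F) (r : D ⊗ D' ~> G) :
  α E F G ∘ box (box p q) r = box p (box q r) ∘ (α A B D ⊠ α A' B' D').
Proof.
(* The interchanges are generalized, lest reassociating composites unfold them. *)
rewrite /box; have := mid_tens_assoc A A' B B' D D'.
move: (mid A B A' B') (mid B D B' D') (mid (A ⊗ B) _ _ _) (mid A (B ⊗ D) _ _).
move=> m1 m2 m3 m4.
have -> : ((p ⊠ q) ∘ m1) ⊠ r = ((p ⊠ q) ⊠ r) ∘ (m1 ⊠ idm _).
  by rewrite -(tens_comp T) comp_idr.
have -> : p ⊠ ((q ⊠ r) ∘ m2) = (p ⊠ (q ⊠ r)) ∘ (idm _ ⊠ m2).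
  by rewrite -(tens_comp T) comp_idr.
by rewrite -!comp_assoc (assoc_nat T) !comp_assoc => ->.
Qed.

Lemma box_lunit A A' E (p : A ⊗ A' ~> E) :
  λ E ∘ box (λ 𝟙) p = p ∘ (λ A ⊠ λ A').
Proof.
rewrite -mid_lunit /box; move: (mid _ _ _ _) => m.
rewrite -!comp_assoc -(lunit_nat T); congr (_ ∘ _).
by rewrite comp_assoc -(tens_comp T) comp_idl comp_idr.
Qed.

Lemma box_runit A A' E (p : A ⊗ A' ~> E) :
  ρ E ∘ box p (λ 𝟙) = p ∘ (ρ A ⊠ ρ A').
Proof.
rewrite -mid_runit /box; move: (mid _ _ _ _) => m.
rewrite -!comp_assoc -(runit_nat T); congr (_ ∘ _).
by rewrite comp_assoc -(tens_comp T) comp_idl comp_idr.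
Qed.

Lemma box_comp A B D E A' B' D' E' (k : D ~> E) (k' : D' ~> E')
    (f : A ⊗ B ~> D) (f' : A' ⊗ B' ~> D') :
  (k ⊠ k') ∘ box f f' = box (k ∘ f) (k' ∘ f').
Proof. by rewrite /box -comp_assoc -(tens_comp T). Qed.

Lemma box_tens A0 B0 A B D A0' B0' A' B' D' (f : A ⊗ B ~> D) (f' : A' ⊗ B' ~> D')
    (x : A0 ~> A) (y : B0 ~> B) (x' : A0' ~> A') (y' : B0' ~> B') :
  box f f' ∘ ((x ⊠ x') ⊠ (y ⊠ y')) = box (f ∘ (x ⊠ y)) (f' ∘ (x' ⊠ y')).
Proof. by rewrite /box comp_assoc mid_nat -comp_assoc -(tens_comp T). Qed.

(** For p = q = r = s = m the square is associativity; for components of a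
    morphism and multiplications it is one of the conditions on M-morphisms or
    multiplicativity; for three pairs of components it is one of the equations
    of a composite. *)
Lemma box_square A B D E F G A' B' D' E' F' G'
    (p : A ⊗ B ~> E) (q : E ⊗ D ~> G) (r : B ⊗ D ~> F) (s : A ⊗ F ~> G)
    (p' : A' ⊗ B' ~> E') (q' : E' ⊗ D' ~> G') (r' : B' ⊗ D' ~> F')
    (s' : A' ⊗ F' ~> G') :
  s ∘ (idm A ⊠ r) ∘ α A B D = q ∘ (p ⊠ idm D) ->
  s' ∘ (idm A' ⊠ r') ∘ α A' B' D' = q' ∘ (p' ⊠ idm D') ->
  box s s' ∘ (idm (A ⊗ A') ⊠ box r r') ∘ α (A ⊗ A') (B ⊗ B') (D ⊗ D')
    = box q q' ∘ (box p p' ⊠ idm (D ⊗ D')).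
Proof.
move=> e e'.
rewrite [box r r']/box [box p p']/box tensr_comp tensl_comp.
rewrite -(tens_id T A A') -(tens_id T D D').
rewrite -!comp_assoc !box_tens -e -e' /box !(tens_id T).
rewrite (tens_comp T (α A B D) _ (α A' B' D')).
have := mid_assoc A A' B B' D D'.
move: (mid A A' B B') (mid B B' D D') (mid (A ⊗ B) _ _ _) (mid A A' (B ⊗ D) _).
move=> m1 m2 m3 m4.
by rewrite !comp_assoc => ->.
Qed.

End Interchange.

(** * The M-morphism induced by a semigroup homomorphism *)

Section Sharp.
Context (V : MonoidalCategory) (Q : MorphismClass V) (HQ : Admissible Q).
Let T := mc_ax V.

Definition IsHom (A B : Magma V) (f : A ~> B) : Prop :=
  f ∘ mul A = mul B ∘ (f ⊠ f).

Lemma IsHom_id (A : Magma V) : IsHom (idm A).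
Proof. by rewrite /IsHom (tens_id T) comp_idl comp_idr. Qed.

Lemma IsHom_comp (A B D : Magma V) (g : B ~> D) (f : A ~> B) :
  IsHom g -> IsHom f -> IsHom (g ∘ f).
Proof.
rewrite /IsHom => eg ef.
by rewrite comp_assoc ef -comp_assoc eg comp_assoc (tens_comp T).
Qed.

Lemma IsHom_inverse (A B : Magma V) (f : A ~> B) (g : B ~> A) :
  IsInverse f g -> IsHom f -> IsHom g.
Proof.
rewrite /IsHom => -[gf fg] ef.
rewrite -[LHS]comp_idr -(tens_id T) -fg (tens_comp T) -comp_assoc.
by rewrite (comp_assoc g) -ef -comp_assoc gf comp_idl.
Qed.

Lemma Q_isol (A B D : V) (f : A ~> B) (g : B ~> D) :
  IsIso f -> Q g -> Q (g ∘ f).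
Proof. by move=> /(Q_iso HQ) Qf; apply: (Q_comp HQ). Qed.

Lemma IsIso_tens (A A' B B' : V) (f : A ~> A') (g : B ~> B') :
  IsIso f -> IsIso g -> IsIso (f ⊠ g).
Proof.
move=> [f' [f1 f2]] [g' [g1 g2]]; exists (f' ⊠ g').
by split; rewrite -(tens_comp T) ?f1 ?f2 ?g1 ?g2 (tens_id T).
Qed.

Lemma IsIso_comp (A B D : V) (f : A ~> B) (g : B ~> D) :
  IsIso f -> IsIso g -> IsIso (g ∘ f).
Proof.
move=> [f' [f1 f2]] [g' [g1 g2]]; exists (f' ∘ g'); split.
  by rewrite comp_assoc -(comp_assoc g') g1 comp_idl.
by rewrite comp_assoc -(comp_assoc f) f2 comp_idl.
Qed.

Lemma IsIso_id (A : V) : IsIso (idm A).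
Proof. by exists (idm A); split; rewrite comp_idl. Qed.

(** A square evaluated at generalized elements x, y, z.  In this form the
    morphisms precomposed with the arguments need not be moved across the
    associativity isomorphism at each use. *)
Lemma square_at (A B D E F G X Y Z : V) (p : A ⊗ B ~> E) (q : E ⊗ D ~> G)
    (r : B ⊗ D ~> F) (s : A ⊗ F ~> G) (x : X ~> A) (y : Y ~> B) (z : Z ~> D) :
  s ∘ (idm A ⊠ r) ∘ α A B D = q ∘ (p ⊠ idm D) ->
  s ∘ (x ⊠ (r ∘ (y ⊠ z))) ∘ α X Y Z = q ∘ ((p ∘ (x ⊠ y)) ⊠ z).
Proof.
move=> e; rewrite -[z in RHS]comp_idl (tens_comp T) -comp_assoc -e.
rewrite !comp_assoc (assoc_nat T); congr (_ ∘ _).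
by rewrite -!comp_assoc -(tens_comp T) comp_idl.
Qed.

Lemma mul_assoc (B : Magma V) (X Y Z : V) (x : X ~> B) (y : Y ~> B)
    (z : Z ~> B) : IsSemigroup B ->
  mul B ∘ (x ⊠ (mul B ∘ (y ⊠ z))) ∘ α X Y Z
    = mul B ∘ ((mul B ∘ (x ⊠ y)) ⊠ z).
Proof. by move=> sg; apply: square_at. Qed.

Lemma sharp_IsMHom (A B : Magma V) (f : A ~> B) :
  IsMObject Q B -> IsIso f -> IsHom f -> IsMHom Q (sharp A B f).
Proof.
move=> [sg [_ Qm]] isof homf.
split; [|split; split; rewrite /=].
- by rewrite /IsMMorphism /= (mul_assoc _ _ _ sg).
- by apply: Q_isol => //; apply: IsIso_tens => //; apply: IsIso_id.
- by apply: Q_isol => //; apply: IsIso_tens => //; apply: IsIso_id.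
- rewrite (comp_assoc _ _ (idm A ⊠ _)) -!(tens_comp T) !comp_idl comp_idr.
  by rewrite (mul_assoc _ _ _ sg) comp_assoc -(tens_comp T) homf comp_idl.
- rewrite (comp_assoc _ _ (_ ⊠ idm A)) -(tens_comp T) comp_idl comp_idr.
  rewrite -(mul_assoc _ _ _ sg) (comp_assoc _ _ (idm B ⊠ mul A)) -(tens_comp T).
  by rewrite homf comp_idl.
Qed.

Lemma sharp_composite (A B D : Magma V) (f : A ~> B) (g : B ~> D) :
  IsSemigroup D -> IsHom g ->
  IsComposite (sharp B D g) (sharp A B f) (sharp A D (g ∘ f)).
Proof.
move=> sg homg; split => /=.
  rewrite (comp_assoc _ _ (idm A ⊠ _)) -!(tens_comp T) comp_idl comp_idr.
  rewrite (mul_assoc _ _ _ sg) comp_assoc -(tens_comp T) -comp_assoc homg.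
  by rewrite comp_assoc -(tens_comp T) comp_idl comp_idr.
rewrite (comp_assoc _ _ (_ ⊠ idm A)) -(tens_comp T) comp_idl comp_idr.
rewrite -(mul_assoc _ _ _ sg) (comp_assoc _ _ (idm D ⊠ (mul B ∘ _))).
rewrite -(tens_comp T) -comp_assoc homg comp_idl !comp_assoc -(tens_comp T).
by rewrite comp_idr.
Qed.

(** The common composite h has components f'_1.u1 and f'_2.1u; it solves the
    second pair of equations because the components of f' are also compatible
    with the multiplication of B' (the composite of f' with the identity). *)
Lemma sharp_natural (A A' B B' : Magma V) (u : A ~> A') (u' : B ~> B')
    (f : Components A B) (f' : Components A' B') :
  IsMMorphism f' -> Multiplicative f' -> IsSemigroup B' -> NonDegenerate B' ->
  u' ∘ f.₁ = f'.₁ ∘ (u ⊠ u') -> u' ∘ f.₂ = f'.₂ ∘ (u' ⊠ u) ->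
  exists h : Components A B',
    IsComposite f' (sharp A A' u) h /\ IsComposite (sharp B B' u') f h.
Proof.
move=> Mf [m1 m2] sg nd e1 e2.
have [/= l1 l2] := id_composite_l HQ Mf sg nd.
exists {| fst_ := f'.₁ ∘ (u ⊠ idm B'); snd_ := f'.₂ ∘ (idm B' ⊠ u) |}.
split; split => /=.
- rewrite -(square_at _ _ _ m1) (tens_id T) comp_idr.
  by rewrite (comp_assoc _ _ (idm A ⊠ _)) -(tens_comp T) comp_idl comp_idr.
- rewrite (square_at _ _ _ (eq_sym m2)) (tens_id T) comp_idr comp_assoc.
  by rewrite -(tens_comp T) comp_idl comp_idr.
- rewrite (comp_assoc _ _ (idm A ⊠ _)) -(tens_comp T) comp_idl comp_idr.
  rewrite (square_at _ _ _ l1) -e1.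
  by rewrite comp_assoc -(tens_comp T) comp_idl.
- rewrite (comp_assoc _ _ (_ ⊠ idm A)) -(tens_comp T) comp_idl comp_idr.
  rewrite -(square_at _ _ _ (eq_sym l2)) -e2.
  by rewrite tensr_comp !comp_assoc.
Qed.
End Sharp.

(** * Non-degeneracy of products *)

Section Nondegenerate.
Context (V : BraidedMonoidalCategory).
Let T := mc_ax V.

Lemma mul_flattens (A : Magma V) :
  flattens (s := Prod (Leaf A) (Leaf A)) (t := Leaf A) (mul A)
    (@lift V (Prod (Leaf A) (Leaf A)) (Leaf A) (mul A)).
Proof. exact: lift_flattens. Qed.

(** Multiplying f on the right by A B is the same as multiplying it by B, moving
    the factor B of the result to the left of A by the inverse braiding, and
    multiplying by A.  In place of the inverse, k is given by an equation.  The
    braiding c_{B,A} on the inputs makes the argument from B come before the one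
    from A, which turns the braiding inside the multiplication of A B into
    c_{BB,A}, past which the multiplication of B can be moved. *)
Lemma prod_mul_right (A B : Magma V) (X Y : V) (f : X ~> Y ⊗ A ⊗ B)
    (k : X ⊗ B ~> (Y ⊗ B) ⊗ A) :
  (idm Y ⊠ braid B A) ∘ α Y B A ∘ k
    = α Y A B ∘ ((idm (Y ⊗ A) ⊠ mul B) ∘ α (Y ⊗ A) B B
        ∘ ((αi Y A B ∘ f) ⊠ idm B)) ->
  (idm Y ⊠ braid B A) ∘ α Y B A
      ∘ ((idm (Y ⊗ B) ⊠ mul A) ∘ α (Y ⊗ B) A A ∘ (k ⊠ idm A))
    = (idm Y ⊠ mul (prodMagma A B)) ∘ α Y (A ⊗ B) (A ⊗ B)
        ∘ (f ⊠ idm (A ⊗ B)) ∘ ((idm X ⊠ braid B A) ∘ α X B A).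
Proof.
rewrite /= /mid => e; flatten V at W.
flatten_in V (A ⊗ W) e.
have natA := swaps_nat_r (Leaf B) (t := Prod (Leaf A) (Leaf A)) (t' := Leaf A) W
  (mul_flattens A).
have natB := swaps_nat_l (s := Prod (Leaf B) (Leaf B)) (s' := Leaf B) (Leaf A) W
  (mul_flattens B).
have natf := flattens_nat
  (lift_flattens (s := Leaf X) (t := Prod (Leaf Y) (Prod (Leaf A) (Leaf B))) f)
  (swap B A W).
cbn in natA, natB, natf.
rewrite natf -!comp_assoc -!tensr_comp natA !tensr_comp !comp_assoc e.
rewrite -!comp_assoc; congr (_ ∘ _).
by rewrite !comp_assoc -!tensr_comp natB.
Qed.

(** Mirror image: first multiply by A, then move the factor B to the front and
    multiply by B.  The braidings combine to c_{B,AA}. *)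
Lemma prod_mul_left (A B : Magma V) (X Y : V) (f : X ~> (A ⊗ B) ⊗ Y)
    (k : A ⊗ X ~> B ⊗ A ⊗ Y) :
  (braid B A ⊠ idm Y) ∘ αi B A Y ∘ k
    = αi A B Y ∘ ((mul A ⊠ idm (B ⊗ Y)) ∘ αi A A (B ⊗ Y)
        ∘ (idm A ⊠ (α A B Y ∘ f))) ->
  (braid B A ⊠ idm Y) ∘ αi B A Y
      ∘ ((mul B ⊠ idm (A ⊗ Y)) ∘ αi B B (A ⊗ Y) ∘ (idm B ⊠ k))
    = (mul (prodMagma A B) ⊠ idm Y) ∘ αi (A ⊗ B) (A ⊗ B) Y
        ∘ (idm (A ⊗ B) ⊠ f) ∘ ((braid B A ⊠ idm X) ∘ αi B A X).
Proof.
rewrite /= /mid => e; flatten V at W.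
flatten_in V W e.
have natA := swaps_nat_r (Leaf B) (t := Prod (Leaf A) (Leaf A)) (t' := Leaf A)
  (B ⊗ Y ⊗ W) (mul_flattens A).
have natB := swaps_nat_l (s := Prod (Leaf B) (Leaf B)) (s' := Leaf B) (Leaf A)
  (Y ⊗ W) (mul_flattens B).
have natmA := flattens_nat (mul_flattens A)
  (lift (s := Prod (Leaf B) (Leaf B)) (t := Leaf B) (mul B) (Y ⊗ W)).
cbn in natA, natB, natmA.
rewrite (tail natmA) (tail natB) !comp_assoc -tensr_comp e tensr_comp.
by rewrite (tail natA) !comp_assoc swap_nat.
Qed.

Lemma nondeg_inj_r (D : Magma V) (X Y : V) (f f' : X ~> Y ⊗ D) :
  NonDegenerate D ->
  (idm Y ⊠ mul D) ∘ α Y D D ∘ (f ⊠ idm D)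
    = (idm Y ⊠ mul D) ∘ α Y D D ∘ (f' ⊠ idm D) -> f = f'.
Proof. by move=> nd; apply: (proj1 (nd X Y)). Qed.

Lemma nondeg_inj_l (D : Magma V) (X Y : V) (f f' : X ~> D ⊗ Y) :
  NonDegenerate D ->
  (mul D ⊠ idm Y) ∘ αi D D Y ∘ (idm D ⊠ f)
    = (mul D ⊠ idm Y) ∘ αi D D Y ∘ (idm D ⊠ f') -> f = f'.
Proof. by move=> nd; apply: (proj2 (nd X Y)). Qed.

Lemma prodMagma_NonDegenerate (A B : Magma V) :
  NonDegenerate A -> NonDegenerate B -> NonDegenerate (prodMagma A B).
Proof.
move=> ndA ndB X Y; have [ci [ciK cKi]] := braid_iso B A.
(* h multiplies by one factor, and k is h followed by the inverse braiding. *)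
split=> [f f' e | g g' e].
  pose h (f : X ~> Y ⊗ A ⊗ B) : X ⊗ B ~> Y ⊗ A ⊗ B :=
    α Y A B ∘ ((idm (Y ⊗ A) ⊠ mul B) ∘ α (Y ⊗ A) B B ∘ ((αi Y A B ∘ f) ⊠ idm B)).
  pose k f := αi Y B A ∘ ((idm Y ⊠ ci) ∘ h f).
  have kP z : (idm Y ⊠ braid B A) ∘ α Y B A ∘ k z = h z.
    rewrite /k; move: (h z) => hz.
    rewrite -!comp_assoc (comp_assoc _ (α _ _ _)) assocKi comp_idr.
    by rewrite -tensr_comp cKi (tens_id T) comp_idl.
  have eh : h f = h f'.
    rewrite -!kP; congr (_ ∘ _); apply: (nondeg_inj_r ndA).
    apply: (iso_mono (q := (idm Y ⊠ braid B A) ∘ α Y B A)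
                     (q' := αi Y B A ∘ (idm Y ⊠ ci))).
      rewrite !comp_assoc -(comp_assoc _ _ (α Y B A)) -tensr_comp ciK.
      by rewrite (tens_id T) comp_idl assocK.
    by rewrite (prod_mul_right (kP f)) (prod_mul_right (kP f')) e.
  apply: (iso_mono (assocKi _ _ _)); apply: (nondeg_inj_r ndB).
  exact: (iso_mono (assocK _ _ _) eh).
pose h (g : X ~> (A ⊗ B) ⊗ Y) : A ⊗ X ~> (A ⊗ B) ⊗ Y :=
  αi A B Y ∘ ((mul A ⊠ idm (B ⊗ Y)) ∘ αi A A (B ⊗ Y) ∘ (idm A ⊠ (α A B Y ∘ g))).
pose k g := α B A Y ∘ ((ci ⊠ idm Y) ∘ h g).
have kP z : (braid B A ⊠ idm Y) ∘ αi B A Y ∘ k z = h z.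
  rewrite /k; move: (h z) => hz.
  rewrite -!comp_assoc (comp_assoc _ (αi _ _ _)) assocK comp_idr.
  by rewrite -tensl_comp cKi (tens_id T) comp_idl.
have eh : h g = h g'.
  rewrite -!kP; congr (_ ∘ _); apply: (nondeg_inj_l ndB).
  apply: (iso_mono (q := (braid B A ⊠ idm Y) ∘ αi B A Y)
                   (q' := α B A Y ∘ (ci ⊠ idm Y))).
    rewrite !comp_assoc -(comp_assoc _ _ (αi B A Y)) -tensl_comp ciK.
    by rewrite (tens_id T) comp_idl assocKi.
  by rewrite (prod_mul_left (kP g)) (prod_mul_left (kP g')) e.
apply: (iso_mono (assocK _ _ _)); apply: (nondeg_inj_l ndA).
exact: (iso_mono (assocKi _ _ _) eh).
Qed.
End Nondegenerate.

(** * The monoidal structure *)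

Section Closure.
Context (V : BraidedMonoidalCategory) (Q : MorphismClass V)
  (HQ : Admissible Q).
Let T := mc_ax V.

Lemma IsInverse_IsIso (A B : V) (f : A ~> B) (g : B ~> A) :
  IsInverse f g -> IsIso f /\ IsIso g.
Proof. by move=> [gf fg]; split; [exists g | exists f]. Qed.

Lemma mid_IsIso (A B D E : V) : IsIso (mid A B D E).
Proof.
have isoa (X Y Z : V) := IsInverse_IsIso (assoc_iso T X Y Z).
apply: IsIso_comp; first exact: (proj1 (isoa _ _ _)).
apply: IsIso_comp; last exact: (proj2 (isoa _ _ _)).
apply: IsIso_tens; first exact: IsIso_id.
apply: IsIso_comp; first exact: (proj2 (isoa _ _ _)).
apply: IsIso_comp; last exact: (proj1 (isoa _ _ _)).
by apply: IsIso_tens; [apply: braid_iso | apply: IsIso_id].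
Qed.

Lemma Q_box (A B D A' B' D' : V) (f : A ⊗ B ~> D) (f' : A' ⊗ B' ~> D') :
  Q f -> Q f' -> Q (box f f').
Proof.
by move=> Qf Qf'; apply: Q_isol (mid_IsIso _ _ _ _) _ => //; apply: Q_tens.
Qed.

Lemma prodMagma_IsMObject (A B : Magma V) :
  IsMObject Q A -> IsMObject Q B -> IsMObject Q (prodMagma A B).
Proof.
move=> [sgA [ndA QA]] [sgB [ndB QB]]; split; [|split].
- symmetry; exact: (box_square (eq_sym sgA) (eq_sym sgB)).
- exact: prodMagma_NonDegenerate.
- exact: Q_box.
Qed.

Lemma unitMagma_IsMObject : IsMObject Q (unitMagma V).
Proof.
split; [|split].
- by rewrite /IsSemigroup /=; flatten V at W.
- move=> X Y /=; split=> f f'.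
    have -> : (idm Y ⊠ λ 𝟙) ∘ α Y 𝟙 𝟙 = ρ (Y ⊗ 𝟙) by flatten V at W.
    have [_ e] := runit_iso T X.
    by rewrite !(runit_nat T); apply: iso_epi e.
  have -> : (λ 𝟙 ⊠ idm Y) ∘ αi 𝟙 𝟙 Y = λ (𝟙 ⊗ Y) by flatten V at W.
  have [_ e] := lunit_iso T X.
  by rewrite !(lunit_nat T); apply: iso_epi e.
- by apply: (Q_iso HQ); case: (IsInverse_IsIso (lunit_iso T 𝟙)).
Qed.

Lemma prodComponents_IsMHom (A A' B B' : Magma V) (f : Components A B)
    (f' : Components A' B') :
  IsMHom Q f -> IsMHom Q f' -> IsMHom Q (prodComponents f f').
Proof.
move=> [Mf [[d1 d2] [m1 m2]]] [Mf' [[d1' d2'] [m1' m2']]].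
split; [|split; split].
- exact: (box_square Mf Mf').
- exact: Q_box.
- exact: Q_box.
- exact: (box_square m1 m1').
- symmetry; exact: (box_square (eq_sym m2) (eq_sym m2')).
Qed.

Lemma prodComponents_IsComposite (A B D A' B' D' : Magma V)
    (f : Components A B) (g : Components B D) (h : Components A D)
    (f' : Components A' B') (g' : Components B' D') (h' : Components A' D') :
  IsComposite g f h -> IsComposite g' f' h' ->
  IsComposite (prodComponents g g') (prodComponents f f') (prodComponents h h').
Proof.
move=> [e1 e2] [e1' e2']; split; first exact: (box_square e1 e1').
symmetry; exact: (box_square (eq_sym e2) (eq_sym e2')).
Qed.

Lemma prodComponents_sharp (A A' B B' : Magma V) (f : A ~> B) (f' : A' ~> B') :
  prodComponents (sharp A B f) (sharp A' B' f')
    = sharp (prodMagma A A') (prodMagma B B') (f ⊠ f').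
Proof.
apply: components_eq; rewrite /= -(tens_id T).
  exact: (eq_sym (box_tens _ _ _ _ _ _)).
exact: (eq_sym (box_tens _ _ _ _ _ _)).
Qed.

Lemma sharp_id (A : Magma V) : sharp A A (idm A) = idComponents A.
Proof. by rewrite /sharp (tens_id T) comp_idr. Qed.

Lemma IsHom_tens (A A' B B' : Magma V) (f : A ~> B) (f' : A' ~> B') :
  IsHom f -> IsHom f' ->
  IsHom (A := prodMagma A A') (B := prodMagma B B') (f ⊠ f').
Proof.
move=> e e'; rewrite /IsHom.
rewrite (box_comp _ _ (mul A) (mul A')) e e'.
exact: (eq_sym (box_tens _ _ _ _ _ _)).
Qed.

Lemma assoc_IsHom (A B D : Magma V) :
  IsHom (A := prodMagma (prodMagma A B) D) (B := prodMagma A (prodMagma B D))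
    (α A B D).
Proof. exact: box_assoc. Qed.

Lemma lunit_IsHom (A : Magma V) :
  IsHom (A := prodMagma (unitMagma V) A) (B := A) (λ A).
Proof. exact: box_lunit. Qed.

Lemma runit_IsHom (A : Magma V) :
  IsHom (A := prodMagma A (unitMagma V)) (B := A) (ρ A).
Proof. exact: box_runit. Qed.

Lemma monoidal_closure : MonoidalClosure Q.
Proof.
have objP := fun A B : MObject Q => prodMagma_IsMObject (mob_ax A) (mob_ax B).
have iso_hom (A B : Magma V) (f : A ~> B) (g : B ~> A) :
    IsInverse f g -> IsHom f -> IsMObject Q A -> IsMObject Q B ->
    IsMHom Q (sharp A B f) /\ IsMHom Q (sharp B A g).
  move=> fg homf MA MB; have [isof isog] := IsInverse_IsIso fg.
  split; apply: (sharp_IsMHom HQ) => //.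
  exact: IsHom_inverse fg homf.
have assocP (A B D : MObject Q) := iso_hom
  (prodMagma (prodMagma A B) D) (prodMagma A (prodMagma B D)) _ _
  (assoc_iso T A B D) (@assoc_IsHom A B D) (prodMagma_IsMObject (objP A B) (mob_ax D))
  (prodMagma_IsMObject (mob_ax A) (objP B D)).
have lunitP (A : MObject Q) := iso_hom
  (prodMagma (unitMagma V) A) A _ _ (lunit_iso T A) (@lunit_IsHom A)
  (prodMagma_IsMObject unitMagma_IsMObject (mob_ax A)) (mob_ax A).
have runitP (A : MObject Q) := iso_hom
  (prodMagma A (unitMagma V)) A _ _ (runit_iso T A) (@runit_IsHom A)
  (prodMagma_IsMObject (mob_ax A) unitMagma_IsMObject) (mob_ax A).
split.
- exact: objP.
- exact: unitMagma_IsMObject.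
- by move=> A A' B B' f f'; apply: prodComponents_IsMHom; apply: mhom_ax.
- by move=> A B D; apply: (proj1 (assocP A B D)).
- by move=> A B D; apply: (proj2 (assocP A B D)).
- by move=> A; apply: (proj1 (lunitP A)).
- by move=> A; apply: (proj2 (lunitP A)).
- by move=> A; apply: (proj1 (runitP A)).
- by move=> A; apply: (proj2 (runitP A)).
Qed.

Lemma compM_sharp (A B D : MObject Q) (f : A ~> B) (g : B ~> D)
    (F : MHom A B) (G : MHom B D) : IsHom g ->
  mhom F = sharp A B f -> mhom G = sharp B D g ->
  mhom (compM HQ G F) = sharp A D (g ∘ f).
Proof.
move=> homg eF eG; symmetry; apply: compM_unique; rewrite eF eG.
by apply: sharp_composite => //; case: (mob_ax D).
Qed.

Lemma compM_sharp_natural (A A' B B' : MObject Q) (u : A ~> A') (u' : B ~> B')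
    (F : MHom A B) (F' : MHom A' B') (U : MHom A A') (U' : MHom B B') :
  mhom U = sharp A A' u -> mhom U' = sharp B B' u' ->
  u' ∘ F.₁ = F'.₁ ∘ (u ⊠ u') -> u' ∘ F.₂ = F'.₂ ∘ (u' ⊠ u) ->
  compM HQ U' F = compM HQ F' U.
Proof.
move=> eU eU' e1 e2.
have [MF' [_ mF']] := mhom_ax F'; have [sg [nd _]] := mob_ax B'.
have [h [h1 h2]] := sharp_natural HQ MF' mF' sg nd e1 e2.
apply: MHom_eq.
rewrite -(compM_unique HQ (g := U') (f := F) (h := h)) ?eU' //.
by apply: compM_unique; rewrite eU.
Qed.
End Closure.

Theorem proposition4p3 (V : BraidedMonoidalCategory) (Q : MorphismClass V)
    (HQ : Admissible Q) :
  exists K : MonoidalClosure Q, IsMonoidal (monoidalDataM HQ K).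
Proof.
have T := mc_ax V; have K := monoidal_closure HQ; exists K.
have inverse (A B : MObject Q) (f : A ~> B) (g : B ~> A) (F : MHom A B)
    (G : MHom B A) : IsInverse f g -> IsHom f -> mhom F = sharp A B f ->
    mhom G = sharp B A g -> IsInverse (C := catM HQ) F G.
  move=> fg homf eF eG; have homg := IsHom_inverse fg homf.
  by case: fg => gf fg; split; apply: MHom_eq;
     rewrite ?(compM_sharp HQ homg eF eG) ?(compM_sharp HQ homf eG eF) ?gf ?fg
       sharp_id.
pose P : MObject Q -> MObject Q -> MObject Q := prodM (HQ := HQ) K.
pose I : MObject Q := unitM HQ K.
have assocP (A B D : MObject Q) := inverse (P (P A B) D) (P A (P B D)) _ _
  (assoc (monoidalDataM HQ K) A B D) (assoc_inv (monoidalDataM HQ K) A B D)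
  (assoc_iso T A B D) (assoc_IsHom A B D) eq_refl eq_refl.
have lunitP (A : MObject Q) := inverse (P I A) A _ _
  (lunit (monoidalDataM HQ K) A) (lunit_inv (monoidalDataM HQ K) A)
  (lunit_iso T A) (lunit_IsHom A) eq_refl eq_refl.
have runitP (A : MObject Q) := inverse (P A I) A _ _
  (runit (monoidalDataM HQ K) A) (runit_inv (monoidalDataM HQ K) A)
  (runit_iso T A) (runit_IsHom A) eq_refl eq_refl.
pose M := monoidalDataM HQ K.
have whr (A B D : MObject Q) (f : B ~> D) (F : MHom B D) :
    mhom F = sharp B D f ->
    mhom (tensM M (idM A) F) = sharp (P A B) (P A D) (idm A ⊠ f).
  by move=> /= ->; rewrite -sharp_id prodComponents_sharp.
have whl (A B D : MObject Q) (f : B ~> D) (F : MHom B D) :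
    mhom F = sharp B D f ->
    mhom (tensM M F (idM A)) = sharp (P B A) (P D A) (f ⊠ idm A).
  by move=> /= ->; rewrite -sharp_id prodComponents_sharp.
have whr_hom (A B D : Magma V) (f : B ~> D) : IsHom f ->
    IsHom (A := prodMagma A B) (B := prodMagma A D) (idm A ⊠ f).
  by move=> homf; apply: IsHom_tens => //; apply: IsHom_id.
have pentagon_lhs (A B D E : MObject Q) :
    mhom (compM HQ (assoc M A B (P D E)) (assoc M (P A B) D E))
      = sharp (P (P (P A B) D) E) (P A (P B (P D E)))
          (α A B (D ⊗ E) ∘ α (A ⊗ B) D E).
  by apply: compM_sharp => //; apply: assoc_IsHom.
split.
- by move=> A B; apply: MHom_eq.
- move=> A A' A'' B B' B'' f f' g g'; apply: MHom_eq; apply: compM_unique.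
  by apply: prodComponents_IsComposite; apply: compMP.
- exact: assocP.
- exact: lunitP.
- exact: runitP.
- move=> A A' B B' D D' f g h; apply: compM_sharp_natural => //; exact: box_assoc.
- move=> A A' f; apply: compM_sharp_natural => //; exact: box_lunit.
- move=> A A' f; apply: compM_sharp_natural => //; exact: box_runit.
- move=> A B D E; apply: MHom_eq; rewrite pentagon_lhs (pentagon T).
  symmetry; apply: (compM_sharp HQ (B := P (P A (P B D)) E)).
  + apply: (IsHom_comp (B := P A (P (P B D) E))); last exact: assoc_IsHom.
    by apply: whr_hom; exact: assoc_IsHom.
  + exact: whl.
  + apply: (compM_sharp HQ (B := P A (P (P B D) E))) => //.
      by apply: whr_hom; exact: assoc_IsHom.
    exact: whr.
- move=> A B; apply: MHom_eq.
  rewrite (whl B (P A I) A (ρ (A : MObject Q)) (runit M A) eq_refl) -(triangle T).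
  apply: (compM_sharp HQ (B := P A (P I B))) => //; last exact: whr.
  by apply: whr_hom; exact: lunit_IsHom.
Qed.
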